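(* Let $B^{c},B^{d}\in\mathbb{R}^{n\times n}$ be adjacency matrices (zero diagonal) such that the signed digraphs $\mathscr{G}(B^{c})$ and $\mathscr{G}(B^{d})$ are sign-consistent. Consider the linear system $$\begin{bmatrix}\dot{x}(t)\\ \dot{y}(t)\end{bmatrix}=\begin{bmatrix}-L_{B^{c}}&I\\ -kL_{B^{d}}&-kI\end{bmatrix}\begin{bmatrix}x(t)\\ y(t)\end{bmatrix},\qquad x(t),y(t)\in\mathbb{R}^{n},$$ and let $k>\mu$ be selected for any $\delta>1$, where $\mu=\mu(\delta)>0$ is the index defined in the context. If the union $\mathscr{G}(B)$ of $\mathscr{G}(B^{c})$ and $\mathscr{G}(B^{d})$ is strongly connected, then under any initial conditions $x(0)\in\mathbb{R}^{n}$ and $y(0)\in\mathbb{R}^{n}$, the following results hold. 1) Polarization can be achieved for the system if and only if $\mathscr{G}(B)$ is structurally balanced for $B=B^{c}+B^{d}$. Moreover, the converged solution of the system is given by $$\lim_{t\to\infty}x(t)=\left\{\nu^{\mathrm{T}}D\left[x(0)+k^{-1}y(0)\right]\right\}D1_{n},\qquad \lim_{t\to\infty}y(t)=0,$$ for some $D\in\mathcal{D}_{n}$ satisfying $DL_{B}D=L_{|B|}$ and some $\nu\in\mathbb{R}^{n}$ satisfying $\nu^{\mathrm{T}}(DL_{B}D)=0$ and $\nu^{\mathrm{T}}1_{n}=1$. 2) Neutralization can be achieved for the system, such that $\lim_{t\to\infty}x(t)=0$ and $\lim_{t\to\infty}y(t)=0$, if and only if $\mathscr{G}(B)$ is structurally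 unbalanced for $B=B^{c}+B^{d}$.
   Context: Let $n\ge 2$, $\mathcal{I}_n=\{1,\dots,n\}$, $1_n=[1,\dots,1]^{\mathrm{T}}\in\mathbb{R}^n$, and $\mathcal{D}_n=\{\mathrm{diag}\{d_1,\dots,d_n\}: d_i\in\{\pm1\}\ \forall i\in\mathcal{I}_n\}$. $I$ and $0$ are identity and zero matrices of compatible dimensions. For a matrix $A=[a_{ij}]$, $|A|=[|a_{ij}|]$ is the entrywise absolute value. $\lambda_{\max}(A)$ is the largest eigenvalue of a matrix $A$ with real eigenvalues. Signed digraphs: an adjacency matrix is a real matrix $B=[b_{ij}]\in\mathbb{R}^{n\times n}$ with $b_{ii}=0$ for all $i$. The signed digraph $\mathscr{G}(B)$ has vertices $v_1,\dots,v_n$ and an arc $(v_j,v_i)$ (from $v_j$ to $v_i$) iff $b_{ij}\neq0$. It is strongly connected if for each pair of distinct vertices there is a directed path from each to the other. Its Laplacian matrix is $L_B=[l^B_{ij}]$ with $l^B_{ii}=\sum_{k\ne i}|b_{ik}|$ and $l^B_{ij}=-b_{ij}$ for $j\neq i$. $\mathscr{G}(B)$ is structurally balanced if the vertex set can be split into two disjoint sets $\mathcal{V}^{(1)},\mathcal{V}^{(2)}$ whose union is the whole vertex set, with $b_{ij}\ge0$ when $v_i,v_j$ are in the same set and $b_{ij}\le0$ when they are in different sets (equivalently, there is $D\in\mathcal{D}_n$ with $DBD=|B|$); otherwise it is structurally unbalanced. $\mathscr{G}(B^c)$ and $\mathscr{G}(B^d)$, with $B^c=[b^c_{ij}]$ and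 $B^d=[b^d_{ij}]$, are sign-consistent if $b^c_{ij}b^d_{ij}\ge0$ for all $i,j\in\mathcal{I}_n$. In that case their union (same vertices, union of the arc sets) is represented by $\mathscr{G}(B)$ with $B=B^c+B^d$. For arbitrary initial states $x_i(0),y_i(0)$, $i\in\mathcal{I}_n$, the system is said to achieve: - polarization (or bipartite consensus) if $\lim_{t\to\infty}|x_i(t)|=\theta$ and $\lim_{t\to\infty}y_i(t)=0$ for all $i\in\mathcal{I}_n$, where $\theta\ge0$ denotes some constant depending on $x_i(0)$ and $y_i(0)$, $i\in\mathcal{I}_n$; - neutralization (or asymptotic stability) if $\lim_{t\to\infty}x_i(t)=0$ and $\lim_{t\to\infty}y_i(t)=0$ for all $i\in\mathcal{I}_n$. Index $\mu$: let $B=B^c+B^d$, $E=[-1_{n-1}\ \ I]\in\mathbb{R}^{(n-1)\times n}$ and $F=\begin{bmatrix}0\\ I\end{bmatrix}\in\mathbb{R}^{n\times(n-1)}$. For $\delta>1$, $$\mu=\frac{\lambda_{\max}(\Phi)\,\lambda_{\max}(\Psi\Psi^{\mathrm{T}})}{2(\delta-1)},$$ where: (i) if $\mathscr{G}(B)$ is structurally balanced, take $D\in\mathcal{D}_n$ with $DL_BD=L_{|B|}$; $\Phi=W$ is the unique positive definite matrix $W\in\mathbb{R}^{(n-1)\times(n-1)}$ solving $[ED(L_{B^c}+L_{B^d})DF]^{\mathrm{T}}W+W[ED(L_{B^c}+L_{B^d})DF]=I$, and $\Psi=ED(L_{B^c}+\delta L_{B^d})DF$; (ii) if $\mathscr{G}(B)$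 is structurally unbalanced, $\Phi=H$ is the unique positive definite matrix $H\in\mathbb{R}^{n\times n}$ solving $(L_{B^c}+L_{B^d})^{\mathrm{T}}H+H(L_{B^c}+L_{B^d})=I$, and $\Psi=L_{B^c}+\delta L_{B^d}$. (Under the strong connectivity and sign-consistency assumptions, these matrices exist and $\mu>0$.)
   Formalization: In polarization, the limit θ is required to be a non-constant function of the initial states x(0), y(0); if θ = 0 for all initial states were allowed, neutralization would count as polarization and the equivalence in 1) would fail for structurally unbalanced digraphs. *)

(* Defs.v *)
From HB Require Import structures.
From mathcomp Require Import all_boot all_order all_algebra.
From mathcomp Require Import all_classical all_reals all_analysis.

Set Implicit Arguments.
Unset Strict Implicit.
Unset Printing Implicit Defensive.

Import Order.TTheory GRing.Theory Num.Theory.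
Import numFieldNormedType.Exports.

Local Open Scope classical_set_scope.
Local Open Scope ring_scope.

Section SignedDigraph.
Variables (R : realType) (n : nat).
Implicit Types B Bc Bd : 'M[R]_n.

Definition adjacency_matrix B : Prop := forall i, B i i = 0.

Definition sign_consistent Bc Bd : Prop := forall i j, 0 <= Bc i j * Bd i j.

(* The entry (i, j) of an adjacency matrix is the weight of the arc going
   from vertex j to vertex i. *)
Definition arc B : rel 'I_n := fun j i => B i j != 0.

Definition strongly_connected B : Prop :=
  forall i j, i != j -> connect (arc B) i j.

(* V is one part of the bipartition, its complement is the other one; either
   part may be empty. *)
Definition structurally_balanced B : bool :=
  [exists V : {set 'I_n}, [forall i, [forall j,
    if (i \in V) == (j \in V) then 0 <= B i j else B i j <= 0]]].

Definition laplacian B : 'M[R]_n :=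
  \matrix_(i, j) (if j == i then \sum_(k | k != i) `|B i k| else - B i j).

Definition absmx B : 'M[R]_n := map_mx Num.norm B.

Definition signature_matrix (D : 'M[R]_n) : Prop :=
  exists2 d : 'rV[R]_n, forall i, d 0 i = 1 \/ d 0 i = -1 & D = diag_mx d.

Definition balancing_matrix B (D : 'M[R]_n) : Prop :=
  signature_matrix D /\ D *m laplacian B *m D = laplacian (absmx B).

End SignedDigraph.

Section Index.
Variable R : realType.

Definition posdefmx m (W : 'M[R]_m) : Prop :=
  W^T = W /\ forall v : 'cV[R]_m, v != 0 -> 0 < (v^T *m W *m v) 0 0.

(* For matrices of positive size all of whose eigenvalues are real, the set
   below is finite and nonempty, so that the supremum is a maximum. *)
Definition lambda_max m (A : 'M[R]_m) : R := sup [set a | eigenvalue A a].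

(* The positive definite X such that A^T X + X A = I; the default value 0 is
   taken only if there is no such matrix. *)
Definition lyapunov_solution m (A : 'M[R]_m) : 'M[R]_m :=
  xget 0 [set X | posdefmx X /\ A^T *m X + X *m A = 1%:M].

Variable n : nat.
Implicit Types (Bc Bd D M : 'M[R]_n) (delta : R).

(* E = [-1 I], entrywise *)
Definition Emx : 'M[R]_(n.-1, n) :=
  \matrix_(i, j) (if j == 0%N :> nat then -1 else (j == i.+1 :> nat)%:R).

(* F = [0; I], entrywise *)
Definition Fmx : 'M[R]_(n, n.-1) := \matrix_(i, j) (i == j.+1 :> nat)%:R.

Definition reduced D M : 'M[R]_n.-1 := Emx *m D *m M *m D *m Fmx.

(* In the balanced case, the balancing matrices of a (strongly) connected
   digraph are equal up to sign, and [reduced] does not depend on the sign. *)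
Definition mu_index Bc Bd delta : R :=
  let M1 := laplacian Bc + laplacian Bd in
  let Mdelta := laplacian Bc + delta *: laplacian Bd in
  let mu m (Phi Psi : 'M[R]_m) :=
    lambda_max Phi * lambda_max (Psi *m Psi^T) / (2 * (delta - 1)) in
  if structurally_balanced (Bc + Bd) then
    let D := xget 0 [set D | balancing_matrix (Bc + Bd) D] in
    mu n.-1 (lyapunov_solution (reduced D M1)) (reduced D Mdelta)
  else mu n (lyapunov_solution M1) Mdelta.

End Index.

Section System.
Variables (R : realType) (n : nat).
Implicit Types (Bc Bd : 'M[R]_n) (k : R).

Definition system_matrix Bc Bd k : 'M[R]_(n + n) :=
  block_mx (- laplacian Bc) 1%:M (- (k *: laplacian Bd)) (- k%:M).

(* Solutions on [0, +oo[; only the values of x and y at nonnegative times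
   matter. *)
Definition is_solution Bc Bd k (x y : R -> 'cV[R]_n) : Prop :=
  let z t : 'cV[R]_(n + n) := col_mx (x t) (y t) in
  (forall t : R, 0 < t -> is_derive t 1 z (system_matrix Bc Bd k *m z t)) /\
  z t @[t --> 0^'+] --> z 0.

(* The common limit theta of the moduli is a function of the initial states
   which genuinely depends on them, i.e., is not constant: an asymptotically
   stable system, for which theta is identically 0, is not polarized. *)
Definition polarization Bc Bd k : Prop :=
  exists theta : 'cV[R]_n -> 'cV[R]_n -> R,
  [/\ forall x0 y0, 0 <= theta x0 y0,
      exists x0 y0 x1 y1, theta x0 y0 <> theta x1 y1 &
      forall x y, is_solution Bc Bd k x y -> forall i,
        `|x t i 0| @[t --> +oo] --> theta (x 0) (y 0) /\
        y t i 0 @[t --> +oo] --> (0 : R)].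

Definition neutralization Bc Bd k : Prop :=
  forall x y, is_solution Bc Bd k x y -> forall i,
    x t i 0 @[t --> +oo] --> (0 : R) /\ y t i 0 @[t --> +oo] --> (0 : R).

End System.

(* Main.v *)
(* With v = y / k and w = x + v the system reads w' = - L x, v' = - Ld x - k v,
   where L = Lc + Ld = L_B by sign-consistency.  If H is positive definite with
   L^T H + H L = I, then V = w^T H w + (delta - 1) v^T H v satisfies
     V' = - |x|^2 - 2 v^T H Psi x - 2 (delta - 1) k v^T H v,  Psi = Lc + delta Ld,
   and since |H v|^2 <= lambda_max(H) v^T H v, completing the square shows that
   k > mu forces V' <= - c V, whence V -> 0.

   The matrix H exists as soon as some positive definite G makes L^T G + G L
   positive definite.  Let nu be the positive left null vector of L_|B| and
   N = diag nu; then
     2 x^T N L_B x = sum_ij nu_i (|b_ij| x_i^2 - 2 b_ij x_i x_j + |b_ij| x_j^2),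
   which vanishes only at 0 when the strongly connected digraph is unbalanced, so
   that G = N works.  In the balanced case, after conjugation by D it vanishes
   only on the line of constant vectors, and the same argument applies to the
   disagreement E D x; moreover nu^T D w is a first integral, which determines
   the limit of x. *)

Require Import Defs.
From HB Require Import structures.
From mathcomp Require Import all_boot all_order all_algebra.
From mathcomp Require Import all_classical all_reals all_analysis.
From mathcomp Require Import ring lra.

Set Implicit Arguments.
Unset Strict Implicit.
Unset Printing Implicit Defensive.

Import Order.TTheory GRing.Theory Num.Theory.
Import numFieldNormedType.Exports.

Local Open Scope classical_set_scope.
Local Open Scope ring_scope.

(** * Quadratic forms and Rayleigh quotients *)

Section BilinearForm.
Variables (R : realType) (m : nat).
Implicit Types (M G : 'M[R]_m) (u v : 'cV[R]_m).

Definition bform M u v : R := (u^T *m M *m v) 0 0.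

Lemma bformE M u v : bform M u v = \sum_i \sum_j u i 0 * M i j * v j 0.
Proof.
rewrite /bform mxE exchange_big /=; apply: eq_bigr => j _.
by rewrite mxE big_distrl; apply: eq_bigr => i _; rewrite mxE.
Qed.

Lemma bform_mul p (A : 'M[R]_(m, p)) (N : 'M[R]_p) (B : 'M[R]_(p, m)) u v :
  bform (A *m N *m B) u v = ((A^T *m u)^T *m N *m (B *m v)) 0 0.
Proof. by rewrite /bform trmx_mul trmxK !mulmxA. Qed.

Lemma bformDl M u1 u2 v : bform M (u1 + u2) v = bform M u1 v + bform M u2 v.
Proof. by rewrite /bform linearD /= !mulmxDl mxE. Qed.

Lemma bformDr M u v1 v2 : bform M u (v1 + v2) = bform M u v1 + bform M u v2.
Proof. by rewrite /bform !mulmxDr mxE. Qed.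

Lemma bformZl M a u v : bform M (a *: u) v = a * bform M u v.
Proof. by rewrite /bform linearZ /= -!scalemxAl mxE. Qed.

Lemma bformZr M a u v : bform M u (a *: v) = a * bform M u v.
Proof. by rewrite /bform -!scalemxAr mxE. Qed.

Lemma bformNl M u v : bform M (- u) v = - bform M u v.
Proof. by rewrite -scaleN1r bformZl mulN1r. Qed.

Lemma bformNr M u v : bform M u (- v) = - bform M u v.
Proof. by rewrite -scaleN1r bformZr mulN1r. Qed.

Lemma bform0 M v : bform M v 0 = 0.
Proof. by rewrite /bform mulmx0 mxE. Qed.

Lemma bformDm M G u v : bform (M + G) u v = bform M u v + bform G u v.
Proof. by rewrite /bform mulmxDr mulmxDl mxE. Qed.

Lemma bformNm M u v : bform (- M) u v = - bform M u v.
Proof. by rewrite /bform mulmxN mulNmx mxE. Qed.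

Lemma bformZm a M u v : bform (a *: M) u v = a * bform M u v.
Proof. by rewrite /bform -scalemxAr -scalemxAl mxE. Qed.

Lemma bform_tr M u v : bform M^T u v = bform M v u.
Proof.
transitivity ((u^T *m M^T *m v)^T 0 0); first by rewrite [RHS]mxE.
by rewrite !trmx_mul !trmxK mulmxA.
Qed.

Lemma bform_sym M u v : M^T = M -> bform M u v = bform M v u.
Proof. by move=> sM; rewrite -bform_tr sM. Qed.

Lemma bform_mulr M G u v : bform (M *m G) u v = bform M u (G *m v).
Proof. by rewrite /bform !mulmxA. Qed.

Lemma bform_mull M G u v : bform (G^T *m M) u v = bform M (G *m u) v.
Proof. by rewrite /bform trmx_mul !mulmxA. Qed.

Lemma bform_mx1 M u v : bform M u v = bform 1%:M u (M *m v).
Proof. by rewrite -bform_mulr mul1mx. Qed.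

Lemma bform1E u v : bform 1%:M u v = \sum_i u i 0 * v i 0.
Proof.
by rewrite /bform mulmx1 mxE; apply: eq_bigr => i _; rewrite mxE.
Qed.

Lemma bform1_ge0 v : 0 <= bform 1%:M v v.
Proof. by rewrite bform1E sumr_ge0// => i _; rewrite -expr2 sqr_ge0. Qed.

Lemma bform1_eq0 v : bform 1%:M v v = 0 -> v = 0.
Proof.
rewrite bform1E => /eqP; rewrite psumr_eq0; last first.
  by move=> i _; rewrite -expr2 sqr_ge0.
move=> /allP v0; apply/matrixP => i j; rewrite ord1 mxE.
by apply/eqP; rewrite -sqrf_eq0 expr2; apply: v0; rewrite mem_index_enum.
Qed.

Lemma bform1_gt0 v : v != 0 -> 0 < bform 1%:M v v.
Proof.
by rewrite lt_def bform1_ge0 andbT; apply: contra => /eqP/bform1_eq0 ->.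
Qed.

Lemma posdefmx1 : posdefmx (1%:M : 'M[R]_m).
Proof. by split; [exact: trmx1 | exact: bform1_gt0]. Qed.

Lemma posdef_ge0 M v : posdefmx M -> 0 <= bform M v v.
Proof.
move=> [_ pM]; have [->|v0] := eqVneq v 0; first by rewrite bform0.
exact/ltW/pM.
Qed.

(** The form is nonnegative at every combination a u + b v; suitable a and b give the inequality. No
    definiteness is assumed, so [bform M v v = 0] is treated apart. *)
Lemma bform_cauchy M u v : M^T = M -> (forall x, 0 <= bform M x x) ->
  bform M u v ^+ 2 <= bform M u u * bform M v v.
Proof.
move=> sM pM.
have key a b : 0 <= a ^+ 2 * bform M u u + 2 * a * b * bform M u v
                    + b ^+ 2 * bform M v v.
  have := pM (a *: u + b *: v).
  rewrite !bformDl !bformDr !bformZl !bformZr (bform_sym v u sM).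
  by move=> h; apply: (le_trans h); rewrite le_eqVlt; apply/orP; left; apply/eqP; ring.
have [v0|v0] := eqVneq (bform M v v) 0.
  rewrite v0 mulr0; have [->|uv0] := eqVneq (bform M u v) 0.
    by rewrite expr0n.
  (* The quadratic in b is now affine with nonzero slope, and this b gives it the value -1. *)
  have := key 1 (- (bform M u u + 1) / (2 * bform M u v)).
  rewrite v0 mulr0 addr0 expr1n mul1r mulr1.
  rewrite (_ : 2 * _ * _ = - (bform M u u + 1)); last by field.
  by rewrite opprD addNKr lerNr oppr0 ler10.
have vpos : 0 < bform M v v by rewrite lt_def v0 pM.
have := key (bform M v v) (- bform M u v).
rewrite (_ : _ + _ = bform M v v *
  (bform M u u * bform M v v - bform M u v ^+ 2)); last by ring.
by rewrite pmulr_rge0// subr_ge0.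
Qed.

(** Cauchy-Schwarz for M v and v bounds |M v|^4 by a multiple of [bform M v v]. *)
Lemma psd_ker M v : M^T = M -> (forall x, 0 <= bform M x x) ->
  bform M v v = 0 -> M *m v = 0.
Proof.
move=> sM pM v0; apply: bform1_eq0.
have := bform_cauchy (M *m v) v sM pM; rewrite v0 mulr0.
rewrite -[X in bform X (M *m v) v]mul1mx bform_mulr => h.
by apply/eqP; rewrite -sqrf_eq0 eq_le h sqr_ge0.
Qed.

(* Maximise the ratio of the two forms on the unit sphere. *)
Lemma gen_rayleigh M G : (0 < m)%N -> M^T = M -> posdefmx G ->
  exists v0, exists a : R, [/\ v0 != 0, M *m v0 = a *: (G *m v0) &
    forall v, bform M v v <= a * bform G v v].
Proof.
move=> m0 sM pG.
(* Row vectors are used so that bounded closed sets are compact by [bounded_closed_compact]. *)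
pose q (N : 'M[R]_m) (r : 'rV[R]_m) := bform N r^T r^T.
have qc N : continuous (q N).
  have -> : q N = fun r => \sum_i \sum_j r 0 i * N i j * r 0 j.
    apply/funext => r; rewrite /q bformE; apply: eq_bigr => i _.
    by apply: eq_bigr => j _; rewrite !mxE.
  apply: continuous_big => [|i _]; first exact: add_continuous.
  apply: continuous_big => [|j _ r]; first exact: add_continuous.
  have cc k : {for r, continuous (fun x : 'rV[R]_m => x 0 k)}.
    exact: coord_continuous.
  exact: (cvgM (cvgM (cc i) (cvg_cst _)) (cc j)).
(* The norm is the maximum norm. This sphere serves as well as the Euclidean one, since the ratio is
   homogeneous of degree 0. *)
pose A := [set r : 'rV[R]_m | `|r| = 1].
have cA : compact A.
  apply: bounded_closed_compact.
    by exists 1; split; [exact: num_real|move=> x x1 r /= ->; exact: ltW].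
  rewrite (_ : A = (fun r : 'rV[R]_m => `|r|) @^-1` [set 1]) //.
  apply: closed_comp => [x _|]; first exact: norm_continuous.
  exact: closed_eq.
have nA (v : 'cV[R]_m) : v != 0 -> A (`|v^T|^-1 *: v^T).
  move=> v0; rewrite /A /= normrZ normfV normr_id mulVf// normr_eq0.
  by rewrite trmx_eq0.
have A0 : A !=set0.
  exists (`|(const_mx 1 : 'cV[R]_m)^T|^-1 *: (const_mx 1 : 'cV[R]_m)^T).
  apply: nA; apply/eqP => /matrixP/(_ (Ordinal m0) 0)/eqP.
  by rewrite !mxE oner_eq0.
have Gpos r : A r -> 0 < q G r.
  move=> Ar; apply: pG.2; rewrite trmx_eq0; apply/eqP => r0.
  by move: Ar; rewrite /A /= r0 normr0 => /eqP; rewrite eq_sym oner_eq0.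
have cf : {within A, continuous (fun r => q M r / q G r)}.
  apply: continuous_in_subspaceT => r /set_mem rA.
  have q0 : q G r != 0 by rewrite gt_eqF// Gpos.
  exact: (cvgM (qc M r) (cvgV q0 (qc G r))).
have [r Ar maxr] := compact_EVT_max A0 cA cf.
rewrite inE in Ar.
have le_a v : bform M v v <= q M r / q G r * bform G v v.
  have [->|v0] := eqVneq v 0; first by rewrite !bform0 mulr0.
  have := maxr _ (mem_set (nA v v0)).
  rewrite /q linearZ /= trmxK !bformZl !bformZr ler_pdivrMr; last first.
    by have := Gpos _ (nA v v0); rewrite /q linearZ /= trmxK bformZl bformZr.
  have c0 : 0 < `|v^T|^-1 by rewrite invr_gt0 normr_gt0 trmx_eq0.
  by rewrite !(mulrCA (_ / _)) !ler_pM2l.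
exists r^T, (q M r / q G r); split => //.
  rewrite trmx_eq0; apply/eqP => r0.
  by move: Ar; rewrite /A /= r0 normr0 => /eqP; rewrite eq_sym oner_eq0.
(* The form of a G - M is nonnegative and vanishes at the maximiser, which therefore lies in its
   kernel. *)
apply/esym/eqP; rewrite -subr_eq0 scalemxAl -mulmxBl; apply/eqP.
apply: psd_ker => [|x|].
- by rewrite linearB /= linearZ /= sM pG.1.
- by rewrite bformDm bformNm bformZm subr_ge0.
- by rewrite bformDm bformNm bformZm -/(q G r) -/(q M r) divfK ?subrr// gt_eqF ?Gpos.
Qed.

(** The maximum of the Rayleigh quotient is an eigenvalue and bounds all the others, so it is the
    supremum defining [lambda_max]. *)
Lemma bform_le_lambda_max M v : (0 < m)%N -> M^T = M ->
  bform M v v <= lambda_max M * bform 1%:M v v.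
Proof.
move=> m0 sM; have [v0 [a [v00 Ma lea]]] := gen_rayleigh m0 sM posdefmx1.
have ea : eigenvalue M a.
  apply/eigenvalueP; exists v0^T; last by rewrite trmx_eq0.
  by rewrite -[RHS]linearZ /= -[M in LHS]sM -trmx_mul Ma mul1mx.
have uba b : eigenvalue M b -> b <= a.
  move=> /eigenvalueP[w wM w0].
  have Mw : M *m w^T = b *: w^T by rewrite -[M]sM -trmx_mul wM linearZ.
  have pw : 0 < bform 1%:M w^T w^T by rewrite bform1_gt0// trmx_eq0.
  have := lea w^T.
  by rewrite -[M in bform M]mul1mx bform_mulr Mw bformZr ler_pM2r.
have la : lambda_max M = a.
  apply/eqP; rewrite eq_le /lambda_max; apply/andP; split.
    by apply: ge_sup; [exists a | move=> b /uba].
  by apply: ub_le_sup => //; exists a => b /uba.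
by rewrite la; exact: lea.
Qed.

(** The constant is minus the maximum of the Rayleigh quotient of -G. *)
Lemma posdef_lower_bound G : posdefmx G ->
  exists2 a, 0 < a & forall v, a * bform 1%:M v v <= bform G v v.
Proof.
move=> pG; have [m0|] := posnP m.
  exists 1 => // v; suff -> : v = 0 by rewrite !bform0 mulr0.
  by apply/matrixP => i; have := ltn_ord i; rewrite {2}m0.
move=> m0; have sG : (- G)^T = - G by rewrite linearN /= pG.1.
have [v0 [a [v00 Ga lea]]] := gen_rayleigh m0 sG posdefmx1.
exists (- a) => [|v]; last by have := lea v; rewrite bformNm lerNl mulNr.
rewrite oppr_gt0 -(pmulr_llt0 _ (bform1_gt0 v00)) -bformZr.
have -> : a *: v0 = - G *m v0 by rewrite Ga mul1mx.
by rewrite -bform_mulr mul1mx bformNm oppr_lt0; apply: pG.2.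
Qed.

End BilinearForm.

(** * Lyapunov equation *)

Section Lyapunov.
Variables (R : realType) (m : nat) (A : 'M[R]_m).
Implicit Types (X G H S : 'M[R]_m).

(* Restricted to symmetric matrices, X |-> A^T X + X A is injective; adding
   X - X^T forces the elements of the kernel to be symmetric. *)
Definition lyapunov_op X : 'M[R]_m :=
  A^T *m (X + X^T) + (X + X^T) *m A + (X - X^T).

Fact lyapunov_op_is_linear : linear lyapunov_op.
Proof.
move=> a X Y; rewrite /lyapunov_op.
have -> : a *: X + Y + (a *: X + Y)^T = a *: (X + X^T) + (Y + Y^T).
  by rewrite linearP /= scalerDr addrACA.
have -> : a *: X + Y - (a *: X + Y)^T = a *: (X - X^T) + (Y - Y^T).
  by rewrite linearP /= scalerBr opprD addrACA.
rewrite mulmxDr mulmxDl -scalemxAr -scalemxAl.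
by rewrite (addrACA (a *: _)) (addrACA (_ + _)) -!scalerDr.
Qed.

HB.instance Definition _ :=
  GRing.isLinear.Build R 'M[R]_m 'M[R]_m _ lyapunov_op lyapunov_op_is_linear.

Lemma trmx_lyapunov S :
  S^T = S -> (A^T *m S + S *m A)^T = A^T *m S + S *m A.
Proof. by move=> sS; rewrite linearD /= !trmx_mul trmxK sS addrC. Qed.

Lemma bform_lyapunov S v :
  S^T = S -> bform (A^T *m S + S *m A) v v = 2 * bform S v (A *m v).
Proof.
move=> sS; rewrite bformDm bform_mull bform_mulr (bform_sym _ _ sS).
by rewrite mulr_natl mulr2n.
Qed.

Variable G : 'M[R]_m.
Hypotheses (m_gt0 : (0 < m)%N) (pG : posdefmx G)
  (pQ : posdefmx (A^T *m G + G *m A)).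

(* If [S v0 = a G v0] at a maximiser [v0] of the ratio of [S] and [G], then the
   quadratic forms of [A^T S + S A] and [a (A^T G + G A)] agree at [v0]. *)
Lemma lyapunov_max S : S^T = S -> exists v0, exists a : R,
  [/\ v0 != 0, bform (A^T *m S + S *m A) v0 v0 =
                 a * bform (A^T *m G + G *m A) v0 v0 &
      forall v, bform S v v <= a * bform G v v].
Proof.
move=> sS; have [v0 [a [v00 Sa lea]]] := gen_rayleigh m_gt0 sS pG.
exists v0, a; split => //; rewrite !bform_lyapunov ?pG.1//.
have sG := pG.1.
rewrite (bform_sym _ _ sS) (bform_sym _ _ sG) mulrCA; congr (_ * _).
by rewrite bform_mx1 Sa bformZr -bform_mx1.
Qed.

(** At the maximiser, 0 is a times a positive number, so the maximal ratio a of S to G is 0. Applied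
    to both S and -S, this makes the form of S vanish. *)
Lemma lyapunov_ker_le0 S v : S^T = S -> A^T *m S + S *m A = 0 ->
  bform S v v <= 0.
Proof.
move=> sS S0; have [v0 [a [v00 ea lea]]] := lyapunov_max sS.
have a0 : a = 0.
  apply/eqP; have /eqP := ea; rewrite S0 /bform mulmx0 mul0mx mxE eq_sym.
  by rewrite mulf_eq0 => /orP[//|]; rewrite gt_eqF//; apply: pQ.2.
by have := lea v; rewrite a0 mul0r.
Qed.

Lemma lyapunov_ker S : S^T = S -> A^T *m S + S *m A = 0 -> S = 0.
Proof.
move=> sS S0.
have S0' v : bform S v v = 0.
  apply/eqP; rewrite eq_le lyapunov_ker_le0//= -oppr_le0 -bformNm.
  apply: lyapunov_ker_le0; first by rewrite linearN /= sS.
  by rewrite mulmxN mulNmx -opprD S0 oppr0.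
have Sv (v : 'cV[R]_m) : S *m v = 0 by apply: psd_ker => // x; rewrite S0'.
apply/matrixP => i j; have /matrixP/(_ i 0) := Sv (delta_mx j 0).
by rewrite -colE !mxE.
Qed.

(** The first two terms of [lyapunov_op] form a symmetric matrix and the last is antisymmetric, so a
    symmetric value kills the latter. *)
Lemma lyapunov_op_sym X Z : Z^T = Z -> lyapunov_op X = Z ->
  X^T = X /\ A^T *m (X + X^T) + (X + X^T) *m A = Z.
Proof.
move=> sZ XZ; set S := X + X^T.
have sS : S^T = S by rewrite /S linearD /= trmxK addrC.
set L := A^T *m S + S *m A.
have sL : L^T = L by exact: trmx_lyapunov.
have XX : X - X^T = 0.
  have : L + (X - X^T) = L - (X - X^T).
    rewrite [LHS]XZ -sZ -[in LHS]XZ linearD /= -/S -/L sL; congr (_ + _).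
    by rewrite linearB /= trmxK opprB.
  move=> /addrI/eqP; rewrite -addr_eq0 -mulr2n -scaler_nat scaler_eq0.
  by rewrite pnatr_eq0 => /eqP.
split; first by apply/esym/subr0_eq.
by rewrite -XZ /lyapunov_op -/S XX addr0.
Qed.

Lemma lyapunov_op_inj X : lyapunov_op X = 0 -> X = 0.
Proof.
move=> /(lyapunov_op_sym (trmx0 _ _ _))[Xs].
have sS : (X + X^T)^T = X + X^T by rewrite Xs linearD /= Xs.
move=> /(lyapunov_ker sS); rewrite Xs -mulr2n => /eqP.
by rewrite -scaler_nat scaler_eq0 pnatr_eq0 => /eqP.
Qed.

(** An injective endomorphism of a finite-dimensional space is onto, which gives a symmetric
    solution; positivity follows by comparison with G. *)
Lemma lyapunov_exists : exists H, posdefmx H /\ A^T *m H + H *m A = 1%:M.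
Proof.
have free : row_free (lin_mx lyapunov_op).
  apply: inj_row_free => v; rewrite -[v]vec_mxK mul_vec_lin.
  move=> /(congr1 vec_mx); rewrite mxvecK linear0 => /lyapunov_op_inj ->.
  by rewrite linear0.
rewrite row_free_unit in free.
set X : 'M[R]_m := vec_mx (mxvec 1%:M *m invmx (lin_mx lyapunov_op)).
have TX : lyapunov_op X = 1%:M.
  apply: (can_inj mxvecK); rewrite -mul_vec_lin /X vec_mxK.
  by rewrite -mulmxA mulVmx// mulmx1.
have [_] := lyapunov_op_sym (trmx1 _ _) TX; set S := X + X^T => L1.
have sS : S^T = S by rewrite /S linearD /= trmxK addrC.
have sNS : (- S)^T = - S by rewrite linearN /= sS.
(* For -S the identity at the maximiser reads -|v0|^2 = a times a positive number. Hence a < 0 and S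
   is at least -a G. *)
have [v0 [a [v00 ea lea]]] := lyapunov_max sNS.
have a0 : a < 0.
  rewrite -(pmulr_llt0 _ (pQ.2 _ v00)) -ea mulmxN mulNmx -opprD L1 bformNm.
  by rewrite oppr_lt0 bform1_gt0.
exists S; split => //; split => // v v0'.
have := lea v; rewrite bformNm lerNl; apply: lt_le_trans.
by rewrite -mulNr mulr_gt0 ?oppr_gt0//; apply: pG.2.
Qed.

End Lyapunov.

(** * Laplacians of signed digraphs *)

Section Laplacian.
Variables (R : realType) (n : nat).
Implicit Types (B C : 'M[R]_n) (u x : 'cV[R]_n).

Lemma laplacianE B i j : adjacency_matrix B ->
  laplacian B i j = (i == j)%:R * (\sum_k `|B i k|) - B i j.
Proof.
move=> B0; rewrite mxE eq_sym; case: eqVneq => [<-|_]; last by rewrite mul0r sub0r.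
by rewrite mul1r B0 subr0 [in RHS](bigD1 i)//= B0 normr0 add0r.
Qed.

Lemma laplacian_mulmx B x i : adjacency_matrix B ->
  (laplacian B *m x) i 0 = \sum_j (`|B i j| * x i 0 - B i j * x j 0).
Proof.
move=> B0; rewrite mxE sumrB -mulr_suml.
under eq_bigr do rewrite laplacianE// mulrBl.
rewrite sumrB; congr (_ - _); rewrite (bigD1 i)//= eqxx mul1r [X in _ + X]big1 ?addr0//.
by move=> j; rewrite eq_sym => /negPf ->; rewrite !mul0r.
Qed.

Lemma mulmx_laplacian B u j : adjacency_matrix B ->
  (u^T *m laplacian B) 0 j = u j 0 * (\sum_k `|B j k|) - \sum_i u i 0 * B i j.
Proof.
move=> B0; rewrite mxE.
under eq_bigr do rewrite laplacianE// mulrBr !mxE.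
rewrite sumrB; congr (_ - _); rewrite (bigD1 j)//= eqxx mul1r [X in _ + X]big1 ?addr0//.
by move=> i /negPf ->; rewrite !mul0r mulr0.
Qed.

Lemma normr_sign_consistent (a b : R) : 0 <= a * b -> `|a + b| = `|a| + `|b|.
Proof.
move=> ab; have [a0|a0|->] := ltgtP a 0; last by rewrite normr0 !add0r.
  have b0 : b <= 0 by move: ab; rewrite nmulr_rge0.
  by rewrite !ler0_norm ?opprD ?(ltW a0)//; lra.
have b0 : 0 <= b by move: ab; rewrite pmulr_rge0.
by rewrite !ger0_norm ?(ltW a0)//; lra.
Qed.

Lemma laplacianD B C : sign_consistent B C ->
  laplacian (B + C) = laplacian B + laplacian C.
Proof.
move=> BC; apply/matrixP => i j; rewrite !mxE; case: ifP => _; last first.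
  by rewrite opprD.
by rewrite -big_split; apply: eq_bigr => k _; rewrite mxE normr_sign_consistent.
Qed.

Lemma sum_norm_absmx B i : \sum_k `|absmx B i k| = \sum_k `|B i k|.
Proof. by apply: eq_bigr => k _; rewrite mxE normr_id. Qed.

Lemma absmx_id B : absmx (absmx B) = absmx B.
Proof. by apply/matrixP => i j; rewrite !mxE normr_id. Qed.

Lemma adjacency_absmx B : adjacency_matrix B -> adjacency_matrix (absmx B).
Proof. by move=> B0 i; rewrite mxE B0 normr0. Qed.

Lemma laplacian_absmx1 B : adjacency_matrix B ->
  laplacian (absmx B) *m (const_mx 1 : 'cV_n) = 0.
Proof.
move=> /adjacency_absmx B0; apply/matrixP => i j.
rewrite ord1 laplacian_mulmx// [RHS]mxE big1// => k _.
by rewrite !mxE normr_id mulr1 subrr.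
Qed.

(** Induction along a directed path: P passes from the tail j of an arc to its head i. *)
Lemma strongly_connected_ind B (P : 'I_n -> Prop) : strongly_connected B ->
  (forall i j, B i j != 0 -> P j -> P i) -> forall i j, P i -> P j.
Proof.
move=> sB step i j Pi; have [<-//|/sB/connectP[p]] := eqVneq i j.
elim: p i Pi => [|k p IHp] i Pi /=; first by move=> _ ->.
by move=> /andP[ik kp] e; apply: (IHp k) => //; exact: step Pi.
Qed.

(* If [u] is a left null vector of the Laplacian then so is its entrywise
   absolute value, whose support is closed under arcs. *)
Lemma laplacian_left_null B :
  (0 < n)%N -> adjacency_matrix B -> strongly_connected B ->
  exists nu : 'cV[R]_n, [/\ forall i, 0 < nu i 0,
    nu^T *m laplacian (absmx B) = 0 & nu^T *m (const_mx 1 : 'cV_n) = 1%:M].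
Proof.
move=> n0 B0 sB; have aB0 := adjacency_absmx B0.
set L := laplacian (absmx B).
have [u u0 uL] : exists2 v : 'rV_n, v != 0 & v *m L = 0.
  apply/det0P; rewrite -det_tr; apply/det0P.
  exists (const_mx 1 : 'cV_n)^T; last by rewrite -trmx_mul laplacian_absmx1 ?trmx0.
  apply/eqP => /matrixP/(_ 0 (Ordinal n0))/eqP.
  by rewrite !mxE oner_eq0.
pose w : 'cV[R]_n := \col_i `|u 0 i|.
(* Triangle inequality in the j-th equation of u L = 0. *)
have le_w j : w j 0 * (\sum_k `|B j k|) <= \sum_i w i 0 * `|B i j|.
  have /matrixP/(_ 0 j) := uL; rewrite -[u]trmxK mulmx_laplacian// [RHS]mxE.
  move=> /eqP; rewrite subr_eq0 => /eqP/(congr1 Num.norm).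
  rewrite sum_norm_absmx normrM [`|\sum_k _|]ger0_norm ?sumr_ge0// !mxE => ->.
  apply: le_trans (ler_norm_sum _ _ _) _; apply: ler_sum => i _.
  by rewrite normrM !mxE normr_id.
(* Summed over j, both sides of the inequality have the same total, so equality holds for each j. *)
have eq_w j : w j 0 * (\sum_k `|B j k|) = \sum_i w i 0 * `|B i j|.
  have : \sum_j (\sum_i w i 0 * `|B i j| - w j 0 * (\sum_k `|B j k|)) == 0.
    rewrite sumrB exchange_big /= subr_eq0; apply/eqP/eq_bigr => i _.
    by rewrite mulr_sumr.
  rewrite psumr_eq0 => [/allP|i _]; last by rewrite subr_ge0.
  by move=> /(_ j (mem_index_enum _)); rewrite subr_eq0 => /eqP.
have w_ge0 i : 0 <= w i 0 by rewrite mxE.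
have w_gt0 i : 0 < w i 0.
  rewrite lt_def w_ge0 andbT; apply: contra u0 => /eqP wi0.
  suff w0 j : w j 0 = 0.
    apply/eqP/matrixP => a b; rewrite ord1 [RHS]mxE.
    by have := w0 b; rewrite mxE => /normr0_eq0.
  apply: (@strongly_connected_ind B (fun j => w j 0 = 0) sB _ i j wi0).
  move=> {i j wi0} i j Bij wj0.
  have /esym/eqP := eq_w j; rewrite wj0 mul0r psumr_eq0 => [/allP|k _]; last first.
    by rewrite mulr_ge0.
  move=> /(_ i (mem_index_enum _)); rewrite mulf_eq0 normr_eq0 (negPf Bij) orbF.
  by move=> /eqP.
have s0 : 0 < \sum_i w i 0.
  by rewrite (bigD1 (Ordinal n0))//= ltr_wpDr// sumr_ge0.
have wL : w^T *m L = 0.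
  apply/matrixP => a j; rewrite ord1 mulmx_laplacian// [RHS]mxE.
  apply/eqP; rewrite subr_eq0; apply/eqP.
  by rewrite sum_norm_absmx eq_w; apply: eq_bigr => i _; rewrite [absmx _ _ _]mxE.
exists ((\sum_i w i 0)^-1 *: w); split => [i||].
- by rewrite mxE mulr_gt0 ?invr_gt0.
- by rewrite linearZ /= -scalemxAl wL scaler0.
- apply/matrixP => a b; rewrite !ord1 linearZ /= -scalemxAl mxE.
  have -> : (w^T *m (const_mx 1 : 'cV_n)) 0 0 = \sum_i w i 0.
    rewrite mxE; apply: eq_bigr => i _.
    by rewrite [w^T _ _]mxE [const_mx _ _ _]mxE mulr1.
  by rewrite mxE mulVf// gt_eqF.
Qed.

Lemma bform_diag (nu : 'cV[R]_n) u x :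
  bform (diag_mx nu^T) u x = \sum_i nu i 0 * (u i 0 * x i 0).
Proof.
rewrite /bform mul_mx_diag mxE; apply: eq_bigr => i _.
by rewrite !mxE mulrCA mulrA.
Qed.

Lemma posdef_diag (nu : 'cV[R]_n) : (forall i, 0 < nu i 0) ->
  posdefmx (diag_mx nu^T).
Proof.
move=> nu0; split=> [|v v0]; first exact: tr_diag_mx.
rewrite -[X in 0 < X]/(bform _ v v) bform_diag.
have sq i : 0 <= nu i 0 * (v i 0 * v i 0).
  by rewrite mulr_ge0 ?(ltW (nu0 i))// -expr2 sqr_ge0.
rewrite lt_def sumr_ge0// andbT psumr_eq0//.
apply: contra v0 => /allP h; apply/eqP/matrixP => i j; rewrite ord1 [RHS]mxE.
have := h i (mem_index_enum _); rewrite mulf_eq0 gt_eqF//= -expr2 sqrf_eq0.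
by move=> /eqP.
Qed.

Lemma laplacian_dirichlet B (nu : 'cV[R]_n) x : adjacency_matrix B ->
  nu^T *m laplacian (absmx B) = 0 ->
  2 * bform (diag_mx nu^T) x (laplacian B *m x) =
  \sum_i \sum_j nu i 0 * (`|B i j| * x i 0 ^+ 2 - 2 * B i j * x i 0 * x j 0
                          + `|B i j| * x j 0 ^+ 2).
Proof.
move=> B0 nuL.
have bal j : nu j 0 * (\sum_k `|B j k|) = \sum_i nu i 0 * `|B i j|.
  have /matrixP/(_ 0 j) := nuL; rewrite mulmx_laplacian; last exact: adjacency_absmx.
  rewrite [RHS]mxE => /eqP; rewrite subr_eq0 => /eqP.
  by rewrite sum_norm_absmx => ->; apply: eq_bigr => i _; rewrite mxE.
(* By [bal], the weighted row and column sums at each vertex coincide, so half of the diagonal part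
   can be moved from x_i^2 to x_j^2. *)
have bal2 : \sum_i \sum_j nu i 0 * `|B i j| * x i 0 ^+ 2 =
            \sum_i \sum_j nu i 0 * `|B i j| * x j 0 ^+ 2.
  rewrite [RHS]exchange_big /=; apply: eq_bigr => i _.
  by rewrite -!mulr_suml -bal mulr_sumr.
rewrite bform_diag mulr_sumr.
have -> : \sum_i 2 * (nu i 0 * (x i 0 * (laplacian B *m x) i 0)) =
  \sum_i \sum_j nu i 0 * (`|B i j| * x i 0 ^+ 2 - 2 * B i j * x i 0 * x j 0)
   + \sum_i \sum_j nu i 0 * `|B i j| * x i 0 ^+ 2.
  rewrite -big_split; apply: eq_bigr => i _ /=; rewrite laplacian_mulmx//.
  rewrite -big_split !mulr_sumr; apply: eq_bigr => j _ /=; ring.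
rewrite bal2 -big_split; apply: eq_bigr => i _ /=.
by rewrite -big_split; apply: eq_bigr => j _ /=; ring.
Qed.

(** Multiplying by [|b|] yields a perfect square, because |b|^2 = b^2; this covers both signs of b
    at once. *)
Lemma dirichlet_termE (b s t : R) :
  `|b| * (`|b| * s ^+ 2 - 2 * b * s * t + `|b| * t ^+ 2) =
  (`|b| * s - b * t) ^+ 2.
Proof.
have bb : `|b| ^+ 2 = b ^+ 2 by rewrite real_normK// num_real.
by ring: bb.
Qed.

Lemma dirichlet_term_ge0 (b s t : R) :
  0 <= `|b| * s ^+ 2 - 2 * b * s * t + `|b| * t ^+ 2.
Proof.
have [->|b0] := eqVneq b 0; first by rewrite normr0; lra.
have nb : 0 < `|b| by rewrite normr_gt0.
by rewrite -(pmulr_rge0 _ nb) dirichlet_termE sqr_ge0.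
Qed.

Lemma dirichlet_term_eq0 (b s t : R) :
  `|b| * s ^+ 2 - 2 * b * s * t + `|b| * t ^+ 2 = 0 -> `|b| * s = b * t.
Proof.
move=> h; apply/eqP; rewrite -subr_eq0 -sqrf_eq0 -dirichlet_termE h.
by rewrite mulr0.
Qed.

Section Positive.
Variables (B : 'M[R]_n) (nu : 'cV[R]_n).
Hypotheses (B0 : adjacency_matrix B) (sB : strongly_connected B)
  (nu_gt0 : forall i, 0 < nu i 0) (nuL : nu^T *m laplacian (absmx B) = 0).

Lemma laplacian_accretive x :
  0 <= bform (diag_mx nu^T) x (laplacian B *m x).
Proof.
rewrite -(@pmulr_rge0 _ 2)// laplacian_dirichlet//.
apply: sumr_ge0 => i _; apply: sumr_ge0 => j _.
by rewrite mulr_ge0 ?(ltW (nu_gt0 i))// dirichlet_term_ge0.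
Qed.

Lemma laplacian_accretive_eq0 x i j :
  bform (diag_mx nu^T) x (laplacian B *m x) = 0 ->
  `|B i j| * x i 0 = B i j * x j 0.
Proof.
move=> /(congr1 ( *%R 2)); rewrite mulr0 laplacian_dirichlet// => /eqP.
have ge0 a b : 0 <= nu a 0 * (`|B a b| * x a 0 ^+ 2 - 2 * B a b * x a 0 * x b 0
                          + `|B a b| * x b 0 ^+ 2).
  by rewrite mulr_ge0 ?(ltW (nu_gt0 a))// dirichlet_term_ge0.
rewrite psumr_eq0 => [/allP/(_ i (mem_index_enum _))|a _]; last exact: sumr_ge0.
rewrite psumr_eq0// => /allP/(_ j (mem_index_enum _)).
rewrite mulf_eq0 gt_eqF//= => /eqP.
exact: dirichlet_term_eq0.
Qed.

(** If the form vanished at x, then |b_ij| x_i = b_ij x_j for all i, j. A zero entry of x would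
    spread to every vertex, so x vanishes nowhere and the signs of its entries give a balancing
    bipartition. *)
Lemma laplacian_unbalanced x : ~~ structurally_balanced B -> x != 0 ->
  0 < bform (diag_mx nu^T) x (laplacian B *m x).
Proof.
move=> uB x0; rewrite lt_def laplacian_accretive andbT.
apply: contra uB => /eqP h; have {}h i j := laplacian_accretive_eq0 i j h.
have nz i : x i 0 != 0.
  apply: contra x0 => /eqP xi0; apply/eqP/matrixP => k l; rewrite ord1 [RHS]mxE.
  apply: (@strongly_connected_ind B (fun j => x j 0 = 0) sB _ i k xi0).
  move=> {i k xi0} i j Bij xj0; have := h i j; rewrite xj0 mulr0 => /eqP.
  by rewrite mulf_eq0 normr_eq0 (negPf Bij) => /eqP.
apply/existsP; exists (finset (fun i => 0 < x i 0)).
apply/forallP => i; apply/forallP => j.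
rewrite !inE; have := h i j.
have [b0|b0|->] := ltgtP (B i j) 0; last by case: ifP.
- rewrite ltr0_norm// mulNr -mulrN => /(mulfI (ltr0_neq0 b0)) <-.
  by rewrite oppr_gt0; case: ltgtP (nz i) => //=.
- by rewrite gtr0_norm// => /(mulfI (lt0r_neq0 b0)) ->; rewrite eqxx.
Qed.

End Positive.

Lemma laplacian_absmx_const B (nu : 'cV[R]_n) x : adjacency_matrix B ->
  strongly_connected B ->
  (forall i, 0 < nu i 0) -> nu^T *m laplacian (absmx B) = 0 ->
  bform (diag_mx nu^T) x (laplacian (absmx B) *m x) = 0 ->
  forall i j, x i 0 = x j 0.
Proof.
move=> B0 sB nu0 nuL h i j.
have nuL' : nu^T *m laplacian (absmx (absmx B)) = 0.
  by rewrite absmx_id.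
apply: (@strongly_connected_ind B (fun j => x i 0 = x j 0) sB _ i j (erefl _)).
move=> {j} j k Bjk ->.
have := laplacian_accretive_eq0 (adjacency_absmx B0) nu0 nuL' j k h.
by rewrite !mxE normr_id => /mulfI; rewrite normr_eq0 => /(_ Bjk).
Qed.

Lemma balancingP B D : adjacency_matrix B -> balancing_matrix B D ->
  exists d : 'rV[R]_n, [/\ forall i, d 0 i * d 0 i = 1, D = diag_mx d &
    forall i j, d 0 i * B i j * d 0 j = `|B i j|].
Proof.
move=> B0 [[d d1 ->] DL]; exists d; split => // [i|i j].
  by case: (d1 i) => ->; ring.
have [->|ij] := eqVneq i j; first by rewrite B0 normr0 mulr0 mul0r.
have /matrixP/(_ i j) := DL; rewrite mul_diag_mx mul_mx_diag !mxE eq_sym (negPf ij).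
by rewrite mulrN mulNr => /oppr_inj.
Qed.

Lemma laplacian_conj B (d : 'rV[R]_n) : (forall i, d 0 i * d 0 i = 1) ->
  (forall i j, d 0 i * B i j * d 0 j = `|B i j|) ->
  diag_mx d *m laplacian B *m diag_mx d = laplacian (absmx B).
Proof.
move=> d1 dB; apply/matrixP => i j.
rewrite mul_diag_mx mul_mx_diag !mxE; case: eqVneq => [->|_]; last first.
  by rewrite mulrN mulNr dB.
by rewrite mulrAC d1 mul1r; apply: eq_bigr => k _; rewrite mxE normr_id.
Qed.

(** The conjugated entries of B and C are at most |b_ij| and |c_ij|, while their sum equals |b_ij| +
    |c_ij|; both bounds are thus attained. *)
Lemma sign_consistent_conj B C (d : 'rV[R]_n) : sign_consistent B C ->
  (forall i, d 0 i * d 0 i = 1) ->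
  (forall i j, d 0 i * (B + C) i j * d 0 j = `|(B + C) i j|) ->
  (forall i j, d 0 i * B i j * d 0 j = `|B i j|) /\
  (forall i j, d 0 i * C i j * d 0 j = `|C i j|).
Proof.
move=> BC d1 dBC.
have nd i : `|d 0 i| = 1.
  by apply/eqP; rewrite -sqrp_eq1// real_normK ?num_real// expr2 d1.
have le1 i j (c : R) : d 0 i * c * d 0 j <= `|c|.
  by apply: le_trans (ler_norm _) _; rewrite !normrM !nd mul1r mulr1.
have s i j : d 0 i * B i j * d 0 j + d 0 i * C i j * d 0 j = `|B i j| + `|C i j|.
  by rewrite -normr_sign_consistent// -mulrDl -mulrDr; have := dBC i j; rewrite mxE.
split=> i j; have := s i j; have := le1 i j (B i j); have := le1 i j (C i j); lra.
Qed.

Lemma balancing_exists B : structurally_balanced B ->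
  exists D, balancing_matrix B D.
Proof.
move=> /existsP[V /forallP hV].
pose d : 'rV[R]_n := \row_i (if i \in V then 1 else -1).
have d1 i : d 0 i = 1 \/ d 0 i = -1 by rewrite mxE; case: ifP; [left|right].
exists (diag_mx d); split; first by exists d.
apply: laplacian_conj => [i|i j]; first by case: (d1 i) => ->; ring.
have := forallP (hV i) j; rewrite !mxE.
by case: (i \in V); case: (j \in V) => /=;
  first [move=> /ger0_norm -> | move=> /ler0_norm ->]; ring.
Qed.

End Laplacian.

(** * Decay of functions satisfying a differential inequality *)

Section Calculus.
Variable R : realType.

Lemma is_derive_mxP m (u : R -> 'cV[R]_m) (du : 'cV[R]_m) (t : R) :
  is_derive t 1 u du <-> forall i, is_derive t 1 (fun s => u s i 0) (du i 0).
Proof.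
split=> [[/[dup] du1 /derivable_mxP du2 du3] i|du1].
  by apply: DeriveDef => //; rewrite -du3 derive_mx// mxE.
have d : derivable u t 1.
  by apply/derivable_mxP => i j; rewrite ord1; case: (du1 i).
apply: DeriveDef => //; rewrite derive_mx//; apply/matrixP => i j.
by rewrite ord1 mxE; case: (du1 i).
Qed.

Lemma cvg_mxP m (F : set_system R) (u : R -> 'cV[R]_m) (l : 'cV[R]_m) :
  Filter F -> (forall i, u t i 0 @[t --> F] --> l i 0) -> u t @[t --> F] --> l.
Proof.
move=> FF ul; apply/cvgrPdist_le => /= e e0; near=> t.
rewrite /Num.Def.normr/= mx_normrE (bigmax_le _ (ltW e0))//= => i _.
rewrite !mxE/= ord1.
move: i; near: t; apply: filter_forall => /= i.
exact: ((cvgrPdist_le _ _).1 (ul i.1)).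
Unshelve. all: by end_near. Qed.

Lemma is_derive_mulmx m p (A : 'M[R]_(p, m)) (u : R -> 'cV[R]_m) du (t : R) :
  is_derive t 1 u du -> is_derive t 1 (fun s => A *m u s) (A *m du).
Proof.
move=> /is_derive_mxP du1; apply/is_derive_mxP => i.
have -> : (fun s => (A *m u s) i 0) = \sum_j (A i j *: (fun s => u s j 0)).
  by apply/funext => s; rewrite fct_sumE mxE.
by rewrite mxE; apply: is_derive_sum => j; exact: is_deriveZ.
Qed.

Lemma is_derive_bform m (G : 'M[R]_m) (u : R -> 'cV[R]_m) du (t : R) :
  is_derive t 1 u du ->
  is_derive t 1 (fun s => bform G (u s) (u s)) (bform G du (u t) + bform G (u t) du).
Proof.
move=> /is_derive_mxP du1.
have -> : (fun s => bform G (u s) (u s)) =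
  \sum_i \sum_j (G i j *: ((fun s => u s i 0) * (fun s => u s j 0))).
  apply/funext => s; rewrite bformE fct_sumE; apply: eq_bigr => i _.
  rewrite fct_sumE; apply: eq_bigr => j _.
  by rewrite mulrAC mulrC.
rewrite !bformE -big_split /=; apply: is_derive_sum => i.
rewrite -big_split /=; apply: is_derive_sum => j.
have H := is_deriveZ (G i j) (is_deriveM (du1 i) (du1 j)).
apply: is_derive_eq; rewrite /GRing.scale /=; ring.
Qed.

(** Once h < c e / 2, the function (V - e/2) exp(c t) is nonincreasing, so V cannot stay at or above
    e for large t. *)
Lemma decay_comparison (V dV h : R -> R) (c : R) : 0 < c ->
  (forall t : R, 0 < t -> is_derive t 1 V (dV t)) ->
  (forall t : R, 0 < t -> dV t <= - c * V t + h t) ->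
  (forall t : R, 0 <= V t) -> h t @[t --> +oo] --> (0 : R) ->
  V t @[t --> +oo] --> (0 : R).
Proof.
move=> c0 Vd Vle V0 h0; apply/cvgrPdist_lt => /= e e0.
have ce : 0 < c * (e / 2) by rewrite mulr_gt0// divr_gt0.
have [T [Tr hT']] := (cvgrPdist_lt _ _).1 h0 _ ce.
have hT t : T < t -> h t < c * (e / 2).
  by move=> /hT'; rewrite sub0r normrN; apply: le_lt_trans; exact: ler_norm.
pose a := Num.max T 1.
have a0 : 0 < a by rewrite lt_max ltr01 orbT.
pose W t := (V t - e / 2) * expR (c * t).
have Wd (t : R) : 0 < t -> is_derive t 1 W ((dV t + c * (V t - e / 2)) * expR (c * t)).
  move=> t0; have Vt := Vd t t0.
  have Ed : is_derive t 1 (fun s : R => expR (c * s)) (c * expR (c * t)).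
    have cd : is_derive t 1 (fun s : R => c * s) c.
      by have := is_deriveZ c (is_derive_id t (1 : R)); rewrite [_ *: _]mulr1.
    by apply: (is_derive_eq (is_derive1_comp (is_derive_expR (c * t)) cd)); rewrite mulrC.
  have Vd' : is_derive t 1 (fun s : R => V s - e / 2) (dV t).
    by have := is_deriveB Vt (is_derive_cst (e / 2) t (1 : R)); rewrite subr0.
  have := is_deriveM Vd' Ed; rewrite /GRing.scale /= => H.
  by apply: (is_derive_eq H); ring.
have Wni t : a <= t -> W t <= W a.
  move=> at_; apply: (@ler0_derive1_nincry _ W a) => // [x|x|].
  - rewrite in_itv/= andbT => ax.
    by have [] := Wd x (lt_trans a0 ax).
  - rewrite in_itv/= andbT => ax; have x0 := lt_trans a0 ax.
    rewrite derive1E; have [_ ->] := Wd x x0.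
    rewrite mulr_le0_ge0 ?expR_ge0//.
    have Tx : T < x by apply: le_lt_trans ax; rewrite le_max lexx.
    have := Vle x x0; have := hT x Tx; rewrite mulrBr mulNr; lra.
  - apply: derivable_within_continuous => x; rewrite in_itv/= andbT => ax.
    by have [] := Wd x (lt_le_trans a0 ax).
near=> t.
have at_ : a <= t by near: t; apply: nbhs_pinfty_ge; exact: num_real.
rewrite sub0r normrN ger0_norm// ltNge; apply/negP => eV.
have t0 : 0 < t by exact: lt_le_trans at_.
(* If V t >= e, then W t is at least (e/2) exp(c t), which exceeds (e/2) c t; for t large this
   contradicts W t <= W a. *)
have : c * t * (e / 2) < W a.
  apply: lt_le_trans (Wni t at_).
  have ct : c * t < expR (c * t) by have := expR_ge1Dx (c * t); lra.
  have e2 : 0 < e / 2 by rewrite divr_gt0.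
  have : c * t * (e / 2) < expR (c * t) * (e / 2) by rewrite ltr_pM2r.
  move=> /lt_le_trans; apply; rewrite /W [leRHS]mulrC.
  by rewrite ler_wpM2l ?expR_ge0//; lra.
rewrite ltNge => /negP; apply.
rewrite mulrAC -ler_pdivrMl//.
Unshelve. all: by end_near. Qed.

(** The mean value theorem makes f constant on positive times, and the right limit at 0 identifies
    the constant. *)
Lemma constant_of_derive0 (f : R -> R) :
  (forall t : R, 0 < t -> is_derive t 1 f 0) -> f t @[t --> 0^'+] --> f 0 ->
  f t @[t --> +oo] --> f 0.
Proof.
move=> fd f0.
have cst s t : 0 < s -> s <= t -> f t = f s.
  move=> s0 st; apply/eqP; rewrite -subr_eq0.
  have fd' x : x \in `]s, t[ -> is_derive x 1 f (cst 0 x).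
    by rewrite in_itv/= => /andP[sx _]; apply: fd; exact: lt_trans sx.
  have [|x _ ->] := MVT_segment st fd'; last by rewrite mul0r.
  apply: derivable_within_continuous => x; rewrite in_itv/= => /andP[sx _].
  by have [] := fd x (lt_le_trans s0 sx).
have f1 : f 0 = f 1.
  have : f t @[t --> 0^'+] --> f 1.
    apply: cvg_near_cst; near=> t; apply/esym/cst; near: t.
      exact: nbhs_right_gt.
    exact: nbhs_right_le.
  move=> f1; exact: (cvg_unique _ f0 f1).
apply: cvg_near_cst; near=> t; rewrite f1; apply: cst => //.
Unshelve. all: by end_near. Qed.

End Calculus.

(** * Exponential solutions of linear systems *)

Section LinearODE.
Variables (R : realType) (m : nat) (A : 'M[R]_m).
Implicit Types (z : 'cV[R]_m).

(** Taylor coefficients of the i-th coordinate of exp(t A) z, the solution used to realise arbitrary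
    initial states. *)
Definition exp_orbit_coeff z (i : 'I_m) (k : nat) : R :=
  (iter k (mulmx A) z) i 0 / k`!%:R.

Lemma iter_mulmx_bound z i k : `|(iter k (mulmx A) z) i 0| <=
  (\sum_i \sum_j `|A i j|) ^+ k * \sum_i `|z i 0|.
Proof.
have le_sum (f : 'I_m -> R) (i0 : 'I_m) : `|f i0| <= \sum_i `|f i|.
  by rewrite (bigD1 i0)//= lerDl sumr_ge0.
elim: k i => [|k IHk] i; first by rewrite expr0 mul1r (le_sum (fun i => z i 0)).
rewrite iterS mxE; apply: le_trans (ler_norm_sum _ _ _) _.
rewrite exprS -mulrA.
apply: (@le_trans _ _ (\sum_j `|A i j| *
    ((\sum_i \sum_j `|A i j|) ^+ k * \sum_i `|z i 0|))).
  by apply: ler_sum => j _; rewrite normrM ler_wpM2l.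
rewrite -mulr_suml ler_wpM2r//.
  by rewrite mulr_ge0 ?exprn_ge0 ?sumr_ge0// => a _; exact: sumr_ge0.
by rewrite [leRHS](bigD1 i)//= lerDl sumr_ge0// => a _; exact: sumr_ge0.
Qed.

Lemma is_cvg_exp_orbit z i (x : R) : cvgn (pseries (exp_orbit_coeff z i) x).
Proof.
apply: normed_cvg.
set c := \sum_i \sum_j `|A i j|; set M := \sum_i `|z i 0|.
have c0 : 0 <= c by apply: sumr_ge0 => a _; exact: sumr_ge0.
have M0 : 0 <= M by exact: sumr_ge0.
apply: (@series_le_cvg _ _ (fun k => M * exp_coeff (c * `|x|) k)) => [k|k|k|].
- by rewrite /= normr_ge0.
- by rewrite mulr_ge0// exp_coeff_ge0// mulr_ge0.
- rewrite /exp_coeff /exp_orbit_coeff /= normrM normf_div normrX.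
  rewrite [`|_%:R|]ger0_norm// exprMn.
  have -> : M * (c ^+ k * `|x| ^+ k / k`!%:R) = c ^+ k * M / k`!%:R * `|x| ^+ k.
    by ring.
  rewrite ler_wpM2r ?exprn_ge0// ler_wpM2r ?invr_ge0//.
  exact: iter_mulmx_bound.
- have -> : (fun k => M * exp_coeff (c * `|x|) k) = M *: exp_coeff (c * `|x|).
    by [].
  by apply: is_cvg_seriesZ; exact: is_cvg_series_exp_coeff.
Qed.

Lemma pseries_diffs_exp_orbit z i :
  pseries_diffs (exp_orbit_coeff z i) = exp_orbit_coeff (A *m z) i.
Proof.
apply/funext => k; rewrite /pseries_diffs /exp_orbit_coeff -iterSr.
by rewrite factS natrM invfM mulrCA mulVKf.
Qed.

Definition exp_orbit z (t : R) : 'cV[R]_m :=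
  \col_i limn (pseries (exp_orbit_coeff z i) t).

Lemma exp_orbit0 z : exp_orbit z 0 = z.
Proof.
apply/matrixP => i j; rewrite ord1 mxE.
apply/cvg_lim => //; apply: cvg_near_cst; near=> k.
rewrite -[k]prednK; last by near: k; exact: nbhs_infty_gt.
rewrite /pseries /series /= big_nat_recl//= expr0 mulr1.
rewrite /exp_orbit_coeff /= divr1 big1 ?addr0// => l _.
by rewrite expr0n mulr0.
Unshelve. all: by end_near. Qed.

Lemma exp_orbit_mulmx z t : exp_orbit (A *m z) t = A *m exp_orbit z t.
Proof.
apply/matrixP => i j; rewrite ord1 mxE mxE.
under eq_bigr do rewrite mxE.
apply/cvg_lim => //.
rewrite (_ : pseries _ t = fun k => \sum_j A i j * pseries (exp_orbit_coeff z j) t k).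
  apply: cvg_big => [|l _]; first exact: add_continuous.
  by apply: cvgM; [exact: cvg_cst|exact: is_cvg_exp_orbit].
apply/funext => k; rewrite /pseries /series /=.
under [RHS]eq_bigr do rewrite mulr_sumr.
rewrite exchange_big /=; apply: eq_bigr => l _.
rewrite /exp_orbit_coeff -iterSr iterS mxE !mulr_suml.
by apply: eq_bigr => a _; rewrite !mulrA.
Qed.

Lemma is_derive_exp_orbit z (t : R) :
  is_derive t 1 (exp_orbit z) (A *m exp_orbit z t).
Proof.
apply/is_derive_mxP => i; rewrite -exp_orbit_mulmx mxE.
under eq_fun do rewrite mxE.
rewrite -pseries_diffs_exp_orbit.
(* Termwise differentiation needs convergence of the series and of its first two derived series at a
   point beyond |t|. Each derived series is again of this form, with A z in place of z. *)
apply: (@pseries_snd_diffs _ _ (`|t| + 1)); rewrite ?pseries_diffs_exp_orbit.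
- exact: is_cvg_exp_orbit.
- exact: is_cvg_exp_orbit.
- exact: is_cvg_exp_orbit.
- by rewrite [`|_ + 1|]ger0_norm ?addr_ge0// ltrDl.
Qed.

End LinearODE.

(** * Stability of the coupled system *)

Section Convergence.
Variable R : realType.

Lemma is_derive_col_mx m p (u : R -> 'cV[R]_m) (v : R -> 'cV[R]_p) du dv (t : R) :
  is_derive t 1 (fun s => col_mx (u s) (v s)) (col_mx du dv) <->
  is_derive t 1 u du /\ is_derive t 1 v dv.
Proof.
split=> [/is_derive_mxP h|[/is_derive_mxP hu /is_derive_mxP hv]].
  split; apply/is_derive_mxP => i.
    have := h (lshift p i); rewrite col_mxEu.
    by under eq_fun do rewrite col_mxEu.
  have := h (rshift m i); rewrite col_mxEd.
  by under eq_fun do rewrite col_mxEd.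
apply/is_derive_mxP => i; rewrite -(splitK i); case: (fintype.split i) => j /=.
  by rewrite col_mxEu; under eq_fun do rewrite col_mxEu; exact: hu.
by rewrite col_mxEd; under eq_fun do rewrite col_mxEd; exact: hv.
Qed.

Lemma cvg_mx_coord m (F : set_system R) {FF : Filter F}
    (u : R -> 'cV[R]_m) (l : 'cV[R]_m) i :
  u t @[t --> F] --> l -> u t i 0 @[t --> F] --> l i 0.
Proof.
move=> ul; exact: (continuous_cvg FF (@coord_continuous _ _ _ i 0 l) ul).
Qed.

Lemma cvg_mx_coord_norm m (u : R -> 'cV[R]_m) (l : 'cV[R]_m) i :
  u t @[t --> +oo] --> l -> `|u t i 0| @[t --> +oo] --> `|l i 0|.
Proof. by move=> ul; exact: cvg_norm (cvg_mx_coord ul). Qed.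

Lemma cvg_mx_coord0 m (u : R -> 'cV[R]_m) i :
  u t @[t --> +oo] --> (0 : 'cV[R]_m) -> u t i 0 @[t --> +oo] --> (0 : R).
Proof.
move=> u0; have -> : 0 = (0 : 'cV[R]_m) i 0 by rewrite mxE.
exact: cvg_mx_coord.
Qed.

Lemma cvg_mulmx m p (F : set_system R) {FF : Filter F} (A : 'M[R]_(p, m))
    (u : R -> 'cV[R]_m) l :
  u t @[t --> F] --> l -> A *m u t @[t --> F] --> A *m l.
Proof.
move=> ul; apply: cvg_mxP => i; rewrite mxE.
rewrite (_ : (fun t => _) = fun t => \sum_j A i j * u t j 0); last first.
  by apply/funext => t; rewrite mxE.
apply: cvg_big => [|j _]; first exact: add_continuous.
by apply: cvgM; [exact: cvg_cst|exact: cvg_mx_coord].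
Qed.

Lemma cvg0_sqr_le (f V : R -> R) (C : R) : (forall t, f t ^+ 2 <= C * V t) ->
  V t @[t --> +oo] --> (0 : R) -> f t @[t --> +oo] --> (0 : R).
Proof.
move=> fV V0; apply/cvgrPdist_lt => e e0.
have CV : C * V t @[t --> +oo] --> (0 : R).
  by have := cvgM (cvg_cst C) V0; rewrite mulr0; apply.
have e2 : 0 < e ^+ 2 by rewrite exprn_gt0.
have [T [Tr hT]] := (cvgrPdist_lt _ _).1 CV _ e2.
exists T; split => // t /hT; rewrite !sub0r !normrN => h.
rewrite -(@ltr_pXn2r _ 2)// ?nnegrE ?ltW// real_normK ?num_real//.
by apply: le_lt_trans (fV t) _; exact: le_lt_trans (ler_norm _) h.
Qed.

End Convergence.

(** * Lyapunov estimate for the coupled system *)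

Section Stability.
Variables (R : realType) (m : nat) (Mc Md H : 'M[R]_m) (delta k : R).
Let Psi := Mc + delta *: Md.
Hypotheses (m_gt0 : (0 < m)%N) (pH : posdefmx H)
  (lyapH : (Mc + Md)^T *m H + H *m (Mc + Md) = 1%:M) (delta_gt1 : 1 < delta)
  (hk : lambda_max H * lambda_max (Psi *m Psi^T) / (2 * (delta - 1)) < k).

Let PsiT : (Psi *m Psi^T)^T = Psi *m Psi^T.
Proof. by rewrite trmx_mul trmxK. Qed.

Lemma bform_gram v : bform (Psi *m Psi^T) v v = bform 1%:M (Psi^T *m v) (Psi^T *m v).
Proof. by rewrite -[X in X *m _]trmxK -[X in X *m _]mulmx1 bform_mulr bform_mull. Qed.

Let one : 'cV[R]_m := const_mx 1.
Let one_neq0 : one != 0.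
Proof.
apply/eqP => /matrixP/(_ (Ordinal m_gt0) 0)/eqP.
by rewrite !mxE oner_eq0.
Qed.

Lemma lambda_max_posdef_gt0 : 0 < lambda_max H.
Proof.
have := bform_le_lambda_max one m_gt0 pH.1.
rewrite -(pmulr_lgt0 _ (bform1_gt0 one_neq0)); apply: lt_le_trans.
exact: pH.2.
Qed.

Lemma lambda_max_gram_ge0 : 0 <= lambda_max (Psi *m Psi^T).
Proof.
have := bform_le_lambda_max one m_gt0 PsiT.
rewrite -(pmulr_lge0 _ (bform1_gt0 one_neq0)); apply: le_trans.
by rewrite bform_gram bform1_ge0.
Qed.

Lemma gain_gt0 : 0 < k.
Proof.
apply: le_lt_trans hk; rewrite divr_ge0 ?mulr_ge0 ?lambda_max_gram_ge0//.
  exact/ltW/lambda_max_posdef_gt0.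
by rewrite subr_ge0 ltW.
Qed.

(** Cauchy-Schwarz in the form of H, applied to H v and v, bounds |H v|^4 by lambda_max(H) |H v|^2
    v^T H v. *)
Lemma bform_norm_le v : bform 1%:M (H *m v) (H *m v) <= lambda_max H * bform H v v.
Proof.
have [Hv0|Hv0] := eqVneq (H *m v) 0.
  rewrite Hv0 bform0 mulr_ge0 ?posdef_ge0//.
  exact/ltW/lambda_max_posdef_gt0.
have p := bform1_gt0 Hv0; rewrite -(ler_pM2l p) -expr2.
have := bform_cauchy (H *m v) v pH.1 (fun x => posdef_ge0 x pH).
rewrite bform_mx1 => /le_trans; apply.
rewrite mulrA ler_wpM2r ?posdef_ge0// mulrC.
exact: bform_le_lambda_max pH.1.
Qed.

(** The cross term is the scalar product of Psi^T H v and x; Cauchy-Schwarz and the two eigenvalue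
    bounds produce the numerator of mu. *)
Lemma cross_term_le v x : bform H v (Psi *m x) ^+ 2 <=
  lambda_max H * lambda_max (Psi *m Psi^T) * (bform H v v * bform 1%:M x x).
Proof.
have -> : bform H v (Psi *m x) = bform 1%:M (Psi^T *m (H *m v)) x.
  by rewrite /bform mulmx1 !trmx_mul trmxK pH.1 !mulmxA.
have := bform_cauchy (Psi^T *m (H *m v)) x (trmx1 _ _) (@bform1_ge0 _ _).
move=> /le_trans; apply; rewrite mulrA ler_wpM2r ?bform1_ge0//.
rewrite -bform_gram; apply: le_trans (bform_le_lambda_max _ m_gt0 PsiT) _.
apply: le_trans (ler_wpM2l lambda_max_gram_ge0 (bform_norm_le v)) _.
by rewrite mulrCA mulrA.
Qed.

Lemma amgm_bound (X s h kap P Q : R) : 0 <= X -> 0 <= h -> 0 <= P -> 0 <= Q ->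
  s ^+ 2 <= kap * (h * X) -> kap <= P * Q -> 0 <= P * X + 2 * s + Q * h.
Proof.
move=> X0 h0 P0 Q0 sle kPQ; rewrite leNgt; apply/negP => neg.
have a0 : 0 <= P * X by rewrite mulr_ge0.
have b0 : 0 <= Q * h by rewrite mulr_ge0.
have hX : 0 <= h * X by rewrite mulr_ge0.
have s2 : s ^+ 2 <= (P * X) * (Q * h).
  apply: (le_trans sle); rewrite mulrACA [X * h]mulrC.
  by rewrite ler_wpM2r.
move: (P * X) (Q * h) a0 b0 s2 neg => a b a0 b0 s2 neg.
(* This says (2s)^2 > (a + b)^2, whereas s^2 <= a b and 4 a b <= (a + b)^2. *)
have : 0 < (- (2 * s) - (a + b)) * (- (2 * s) + (a + b)).
  by rewrite mulr_gt0//; lra.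
have := sqr_ge0 (a - b); lra.
Qed.

(** The strict inequality k > mu leaves room to subtract a small multiple of |x|^2 + v^T H v and
    still dominate the cross term. *)
Lemma dissipation : exists2 c, 0 < c & forall x v,
  c * (bform H (x + v) (x + v) + (delta - 1) * bform H v v) <=
  bform 1%:M x x + 2 * bform H v (Psi *m x) + 2 * (delta - 1) * k * bform H v v.
Proof.
have d1 : 0 < delta - 1 by rewrite subr_gt0.
set kap := lambda_max H * lambda_max (Psi *m Psi^T).
set kap' := 2 * (delta - 1) * k.
have kk : kap < kap'.
  by move: hk; rewrite ltr_pdivrMr ?mulr_gt0// [k * _]mulrC.
have lH := lambda_max_posdef_gt0.
have kap0 : 0 <= kap by rewrite mulr_ge0 ?lambda_max_gram_ge0 ?ltW.
have kap'1 : 0 < 1 + kap' by lra.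
(* With this c, (1 - c)(kap' - c) = kap + c^2 >= kap, as [amgm_bound] requires. *)
pose c := (kap' - kap) / (1 + kap').
have ckap : c * (1 + kap') = kap' - kap by rewrite /c divfK// gt_eqF.
have c0 : 0 < c by rewrite divr_gt0// subr_gt0.
have c1 : c <= 1 by rewrite ler_pdivrMr//; lra.
have cle : c <= kap'.
  have : 0 <= c * kap' by rewrite mulr_ge0 ?ltW//; exact: le_lt_trans kk.
  lra.
(* The Lyapunov function is at most 2 lambda_max(H) X + (delta + 1) h, hence at most K (X + h). *)
pose K := 2 * lambda_max H + delta + 1.
have K0 : 0 < K by rewrite /K; lra.
exists (c / K) => [|x v]; first by rewrite divr_gt0.
set X := bform 1%:M x x; set h := bform H v v; set s := bform H v _.
have X0 : 0 <= X by exact: bform1_ge0.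
have h0 : 0 <= h by exact: posdef_ge0.
have lower : c * (X + h) <= X + 2 * s + kap' * h.
  have : 0 <= (1 - c) * X + 2 * s + (kap' - c) * h.
    apply: (amgm_bound (kap := kap)) => //; rewrite ?subr_ge0//.
      exact: cross_term_le.
    by have := sqr_ge0 c; lra.
  by lra.
apply: le_trans lower; rewrite mulrAC ler_pdivrMr// -[leRHS]mulrA ler_pM2l//.
have : bform H x x <= lambda_max H * X by exact: bform_le_lambda_max pH.1.
(* Positivity at x - v bounds the mixed term in the form at x + v. *)
have := posdef_ge0 (x + (-1) *: v) pH.
rewrite !bformDl !bformDr !bformZl !bformZr (bform_sym v x pH.1) -/h /K.
have := mulr_ge0 (ltW lH) h0.
have : 0 <= (delta + 1) * X by rewrite mulr_ge0//; lra.
move: (bform H x x) (bform H x v) (lambda_max H) => p q l; lra.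
Qed.

Variables x y : R -> 'cV[R]_m.
Hypotheses
  (xd : forall t : R, 0 < t -> is_derive t 1 x (- (Mc *m x t) + y t))
  (yd : forall t : R, 0 < t ->
     is_derive t 1 y (- (k *: (Md *m x t)) - k *: y t)).

(** To be used with the two Laplacians in the unbalanced case and with their reduced matrices in the
    balanced one. *)
Lemma coupled_stable : x t @[t --> +oo] --> (0 : 'cV[R]_m) /\
  y t @[t --> +oo] --> (0 : 'cV[R]_m).
Proof.
have k0 := gain_gt0.
have d1 : 0 < delta - 1 by rewrite subr_gt0.
pose v t := k^-1 *: y t; pose w t := x t + v t.
pose V t := bform H (w t) (w t) + (delta - 1) * bform H (v t) (v t).
have vd (t : R) : 0 < t -> is_derive t 1 v (- (Md *m x t) - k *: v t).
  move=> t0; have := is_derive_mulmx (k^-1)%:M (yd t0).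
  rewrite mul_scalar_mx scalerBr scalerN !scalerA mulVf ?gt_eqF// mulfV ?gt_eqF//.
  by under eq_fun do rewrite mul_scalar_mx; rewrite !scale1r.
have wd (t : R) : 0 < t -> is_derive t 1 w (- ((Mc + Md) *m x t)).
  move=> t0; have := is_deriveD (xd t0) (vd t t0) => /is_derive_eq; apply.
  rewrite /v scalerA mulfV ?gt_eqF// scale1r mulmxDl opprD addrACA addrC.
  by rewrite addrN add0r.
pose dV t := bform H (- ((Mc + Md) *m x t)) (w t) + bform H (w t) (- ((Mc + Md) *m x t))
  + (delta - 1) * (bform H (- (Md *m x t) - k *: v t) (v t)
                   + bform H (v t) (- (Md *m x t) - k *: v t)).
have Vd (t : R) : 0 < t -> is_derive t 1 V (dV t).
  move=> t0; have Dw := is_derive_bform H (wd t t0).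
  have Dv := is_deriveZ (delta - 1) (is_derive_bform H (vd t t0)).
  exact: (is_deriveD Dw Dv).
(* Substituting w = x + v, the part in x alone is -|x|^2 by the Lyapunov equation, and the terms
   with Mc + Md and (delta - 1) Md add up to Psi. *)
have dVE t : dV t = - (bform 1%:M (x t) (x t) + 2 * bform H (v t) (Psi *m x t)
                       + 2 * (delta - 1) * k * bform H (v t) (v t)).
  have := bform_lyapunov (Mc + Md) (x t) pH.1; rewrite lyapH => ->.
  rewrite /dV (bform_sym _ (w t) pH.1) (bform_sym _ (v t) pH.1) /w /Psi.
  rewrite !mulmxDl -!scalemxAl.
  by rewrite !(bformDl, bformDr, bformNl, bformNr, bformZl, bformZr); ring.
have [c c0 diss] := dissipation.
have V0 t : 0 <= V t.
  by rewrite addr_ge0 ?mulr_ge0 ?posdef_ge0// ltW.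
have Vto0 : V t @[t --> +oo] --> (0 : R).
  apply: (@decay_comparison _ V dV (cst 0) c c0 Vd) => // [t _|].
    by rewrite dVE addr0 mulNr lerN2; exact: diss.
  exact: cvg_cst.
have [a a0 lea] := posdef_lower_bound pH.
have coord_le (u : 'cV[R]_m) i : u i 0 ^+ 2 <= a^-1 * bform H u u.
  rewrite ler_pdivlMl//; apply: le_trans (lea u).
  rewrite ler_pM2l// bform1E (bigD1 i)//= -expr2 lerDl sumr_ge0// => j _.
  by rewrite -expr2 sqr_ge0.
have w0 : w t @[t --> +oo] --> (0 : 'cV[R]_m).
  apply: cvg_mxP => i; rewrite mxE; apply: (cvg0_sqr_le (C := a^-1)) Vto0 => t.
  apply: (le_trans (coord_le _ i)); rewrite ler_pM2l ?invr_gt0// lerDl.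
  by rewrite mulr_ge0 ?posdef_ge0// ltW.
have v0 : v t @[t --> +oo] --> (0 : 'cV[R]_m).
  apply: cvg_mxP => i; rewrite mxE.
  apply: (cvg0_sqr_le (C := a^-1 * (delta - 1)^-1)) Vto0 => t.
  apply: (le_trans (coord_le _ i)); rewrite -mulrA ler_pM2l ?invr_gt0//.
  by rewrite ler_pdivlMl// lerDr posdef_ge0.
split.
  rewrite (_ : x = fun t => w t - v t); last first.
    by apply/funext => t; rewrite /w addrK.
  by rewrite -[X in _ --> X](subr0 0); exact: cvgB.
rewrite (_ : y = fun t => k%:M *m v t); last first.
  by apply/funext => t; rewrite mul_scalar_mx scalerA mulfV ?scale1r// gt_eqF.
by rewrite -[X in _ --> X](mulmx0 _ (k%:M)); exact: cvg_mulmx.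
Qed.

End Stability.

(** * Reduction to the disagreement space *)

Section Reduction.
Variables (R : realType) (n : nat).
Hypothesis hn : (2 <= n)%N.
Let n_gt0 : (0 < n)%N := ltnW hn.
Let ones : 'cV[R]_n := const_mx 1.
Let E := Emx R n.
Let F := Fmx R n.

Let e0 : 'rV[R]_n := \row_j (j == 0%N :> nat)%:R.

(** [F *m E] subtracts the first coordinate from every coordinate; hence a matrix that annihilates
    [ones] factors through [E]. *)
Lemma Fmx_Emx : F *m E = 1%:M - ones *m e0.
Proof.
apply/matrixP => i j; rewrite !mxE big_ord1 !mxE mul1r.
have [i0|i0] := posnP i.
  rewrite big1 => [|l _]; last by rewrite !mxE i0 mul0r.
  rewrite -[RHS]/((i == j :> nat)%:R - _) i0 eq_sym.
  by rewrite subrr.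
have li : (i.-1 < n.-1)%N by rewrite -ltnS !prednK.
rewrite (bigD1 (Ordinal li))//= big1 => [|l ll]; last first.
  rewrite !mxE; case: eqP => [il|]; last by rewrite mul0r.
  by move: ll; rewrite -val_eqE /= il eqxx.
rewrite !mxE /= prednK// eqxx mul1r addr0 -[(i == j)]/(i == j :> nat).
have [->|j0] := eqVneq (j : nat) 0%N.
  by rewrite gtn_eqF// sub0r.
by rewrite subr0 eq_sym.
Qed.

Lemma Emx_Fmx : E *m F = 1%:M.
Proof.
apply/matrixP => i j; rewrite !mxE.
have lj : (j.+1 < n)%N by rewrite -ltn_predRL.
rewrite (bigD1 (Ordinal lj))//= big1 => [|l ll]; last first.
  rewrite [F _ _]mxE; case: eqP => [il|]; last by rewrite mulr0.
  by move: ll; rewrite -val_eqE /= il eqxx.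
by rewrite !mxE /= eqxx mulr1 addr0 eqSS eq_sym.
Qed.

Lemma e0_ones : e0 *m ones = 1%:M.
Proof.
apply/matrixP => i j; rewrite !ord1 !mxE.
rewrite (bigD1 (Ordinal n_gt0))//= big1 => [|l ll].
  by rewrite !mxE eqxx mul1r addr0.
rewrite !mxE; case: eqP => [il|]; last by rewrite mul0r.
by move: ll; rewrite -val_eqE /= il eqxx.
Qed.

Lemma Emx_ones : E *m ones = 0.
Proof.
rewrite -[E]mul1mx -Emx_Fmx -mulmxA -mulmxA [F *m _]mulmxA Fmx_Emx mulmxBl.
by rewrite mul1mx -mulmxA e0_ones mulmx1 subrr mulmx0.
Qed.

Lemma mulmx_Fmx_Emx p (M : 'M[R]_(p, n)) : M *m ones = 0 -> M *m (F *m E) = M.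
Proof.
by move=> M1; rewrite Fmx_Emx mulmxBr mulmx1 mulmxA M1 mul0mx subr0.
Qed.

Variables (B : 'M[R]_n) (nu : 'cV[R]_n).
Hypotheses (B0 : adjacency_matrix B) (sB : strongly_connected B)
  (nu_gt0 : forall i, 0 < nu i 0) (nuL : nu^T *m laplacian (absmx B) = 0)
  (nu1 : nu^T *m ones = 1%:M).
Let L := laplacian (absmx B).

(** G is the form N = diag nu pulled back by Q = P F, where P projects along [ones] onto the kernel
    of nu^T. Q is a right inverse of E and intertwines E L F with L. *)
Lemma reduced_laplacian_stable : exists G,
  posdefmx G /\ posdefmx ((E *m L *m F)^T *m G + G *m (E *m L *m F)).
Proof.
pose P : 'M[R]_n := 1%:M - ones *m nu^T.
have P1 : P *m ones = 0 by rewrite mulmxBl mul1mx -mulmxA nu1 mulmx1 subrr.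
have PL : P *m L = L by rewrite mulmxBl mul1mx -mulmxA nuL mulmx0 subr0.
have nuP : nu^T *m P = 0 by rewrite mulmxBr mulmx1 mulmxA nu1 mul1mx subrr.
have L1 : L *m ones = 0 by exact: laplacian_absmx1.
have LP : L *m P = L by rewrite mulmxBr mulmx1 mulmxA L1 mul0mx subr0.
pose N := diag_mx nu^T.
have pN : posdefmx N by exact: posdef_diag.
pose Q := P *m F.
have EQ : E *m Q = 1%:M.
  by rewrite mulmxA mulmxBr mulmx1 mulmxA Emx_ones mul0mx subr0 Emx_Fmx.
have Q_neq0 (u : 'cV[R]_n.-1) : u != 0 -> Q *m u != 0.
  by apply: contra => /eqP Qu; rewrite -[u]mul1mx -EQ -mulmxA Qu mulmx0.
pose G := Q^T *m N *m Q.
have GE u v : bform G u v = bform N (Q *m u) (Q *m v).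
  by rewrite bform_mul trmxK.
have sG : G^T = G by rewrite (trmx_mul _ Q) (trmx_mul Q^T) trmxK pN.1 mulmxA.
exists G; split.
  split => // v v0; rewrite -[ltRHS]/(bform G v v) GE.
  by apply: pN.2; exact: Q_neq0.
split => [|u u0]; first exact: trmx_lyapunov.
rewrite -[ltRHS]/(bform _ u u) bform_lyapunov// GE.
have -> : Q *m (E *m L *m F *m u) = L *m (Q *m u).
  rewrite !mulmxA; congr (_ *m u).
  rewrite -(mulmxA P F) mulmx_Fmx_Emx// PL.
  by rewrite LP.
rewrite mulr_gt0// lt_def; apply/andP; split; last first.
  by apply: laplacian_accretive (adjacency_absmx B0) _ _ _ => //; rewrite absmx_id.
(* If the form vanishes, Q u is a constant vector; as nu^T Q u = 0 and nu^T 1 = 1, the constant is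
   0. *)
apply: contra (Q_neq0 u u0) => /eqP h.
have Qc := laplacian_absmx_const B0 sB nu_gt0 nuL h.
have c1 : Q *m u = (Q *m u) (Ordinal n_gt0) 0 *: ones.
  by apply/matrixP => i j; rewrite ord1 [RHS]mxE [ones _ _]mxE mulr1; exact: Qc.
have : nu^T *m (Q *m u) = 0 by rewrite !mulmxA nuP !mul0mx.
rewrite c1 -scalemxAr nu1 => /matrixP/(_ 0 0); rewrite !mxE mulr1 => ->.
by rewrite scale0r.
Qed.

End Reduction.

(** * Balanced and unbalanced digraphs *)

Section System.
Variables (R : realType) (n : nat).
Implicit Types (Bc Bd : 'M[R]_n) (k : R) (x y : R -> 'cV[R]_n).

Lemma system_matrix_mulmx Bc Bd k (u v : 'cV[R]_n) :
  system_matrix Bc Bd k *m col_mx u v =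
  col_mx (- (laplacian Bc *m u) + v) (- (k *: (laplacian Bd *m u)) - k *: v).
Proof.
by rewrite mul_block_col mul1mx !mulNmx mul_scalar_mx -scalemxAl.
Qed.

Lemma is_solution_derive Bc Bd k x y : is_solution Bc Bd k x y ->
  forall t : R, 0 < t ->
    is_derive t 1 x (- (laplacian Bc *m x t) + y t) /\
    is_derive t 1 y (- (k *: (laplacian Bd *m x t)) - k *: y t).
Proof.
move=> [zd _] t /zd; rewrite system_matrix_mulmx.
by move=> /is_derive_col_mx.
Qed.

Lemma is_solution_init Bc Bd k x y : is_solution Bc Bd k x y ->
  x t @[t --> 0^'+] --> x 0 /\ y t @[t --> 0^'+] --> y 0.
Proof.
move=> [_ z0]; split; apply: cvg_mxP => i.
  rewrite (_ : (fun t => _) = fun t => col_mx (x t) (y t) (lshift n i) 0).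
    by rewrite -(col_mxEu (x 0) (y 0)); exact: cvg_mx_coord z0.
  by apply/funext => t; rewrite col_mxEu.
rewrite (_ : (fun t => _) = fun t => col_mx (x t) (y t) (rshift n i) 0).
  by rewrite -(col_mxEd (x 0) (y 0)); exact: cvg_mx_coord z0.
by apply/funext => t; rewrite col_mxEd.
Qed.

Lemma is_solution_exists Bc Bd k (x0 y0 : 'cV[R]_n) :
  exists x, exists y, [/\ is_solution Bc Bd k x y, x 0 = x0 & y 0 = y0].
Proof.
pose z := exp_orbit (system_matrix Bc Bd k) (col_mx x0 y0).
exists (fun t => usubmx (z t)), (fun t => dsubmx (z t)).
have zE : (fun t => col_mx (usubmx (z t)) (dsubmx (z t))) = z.
  by apply/funext => t; rewrite vsubmxK.
have zd t := is_derive_exp_orbit (system_matrix Bc Bd k) (col_mx x0 y0) t.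
split; rewrite ?/z ?exp_orbit0 ?col_mxKu ?col_mxKd//.
rewrite /is_solution -/z zE; split => [t _|].
  by rewrite vsubmxK.
rewrite vsubmxK; apply: cvg_at_right_filter.
apply: differentiable_continuous; apply/derivable1_diffP.
by have [] := zd 0.
Qed.

Lemma lyapunov_solutionP m (A G : 'M[R]_m) : (0 < m)%N -> posdefmx G ->
  posdefmx (A^T *m G + G *m A) ->
  posdefmx (lyapunov_solution A) /\
  A^T *m lyapunov_solution A + lyapunov_solution A *m A = 1%:M.
Proof.
move=> m0 pG pQ; have [H HP] := lyapunov_exists m0 pG pQ.
exact: (@xgetPex _ 0 [set X | posdefmx X /\ A^T *m X + X *m A = 1%:M]
  (ex_intro _ H HP)).
Qed.

End System.

(** * Limits of the solutions in the two cases *)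

Section Main.
Variables (R : realType) (n : nat).
Hypothesis hn : (2 <= n)%N.
Let n_gt0 : (0 < n)%N := ltnW hn.
Variables (Bc Bd : 'M[R]_n).
Hypotheses (hBc : adjacency_matrix Bc) (hBd : adjacency_matrix Bd)
  (hsign : sign_consistent Bc Bd).
Variables (delta k : R).
Hypotheses (hdelta : 1 < delta) (hk : mu_index Bc Bd delta < k)
  (hconn : strongly_connected (Bc + Bd)).
Let B := Bc + Bd.
Let ones : 'cV[R]_n := const_mx 1.

Lemma adjacency_matrixD : adjacency_matrix B.
Proof. by move=> i; rewrite mxE hBc hBd addr0. Qed.
Let B0 := adjacency_matrixD.

Lemma unbalanced_stable x y : ~~ structurally_balanced B ->
  is_solution Bc Bd k x y ->
  x t @[t --> +oo] --> (0 : 'cV[R]_n) /\ y t @[t --> +oo] --> (0 : 'cV[R]_n).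
Proof.
move=> uB sol; have solD := is_solution_derive sol.
have [nu [nu_gt0 nuL _]] := laplacian_left_null n_gt0 B0 hconn.
have pG := posdef_diag nu_gt0.
have pQ : posdefmx ((laplacian Bc + laplacian Bd)^T *m diag_mx nu^T
                    + diag_mx nu^T *m (laplacian Bc + laplacian Bd)).
  split=> [|v v0]; first exact: trmx_lyapunov pG.1.
  rewrite -[ltRHS]/(bform _ v v) bform_lyapunov ?pG.1// mulr_gt0//.
  rewrite -laplacianD//; exact: laplacian_unbalanced.
have [pH lyap] := lyapunov_solutionP n_gt0 pG pQ.
apply: (coupled_stable (k := k) n_gt0 pH lyap hdelta) => [|t /solD[]//|t /solD[]//].
by move: hk; rewrite /mu_index (negPf uB).
Qed.

Hypothesis bB : structurally_balanced B.
(** The same choice as in [mu_index], so that the bound on k concerns this very D. *)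
Let D : 'M[R]_n := xget 0 [set D | balancing_matrix B D].

Lemma balancing_xget : balancing_matrix B D.
Proof. exact: xgetPex (balancing_exists bB). Qed.

Variable nu : 'cV[R]_n.
Hypotheses (nu_gt0 : forall i, 0 < nu i 0)
  (nuL : nu^T *m laplacian (absmx B) = 0) (nu1 : nu^T *m ones = 1%:M).

Lemma signature_involutive : D *m D = 1%:M.
Proof.
have [d [d1 -> _]] := balancingP B0 balancing_xget.
rewrite mulmx_diag; apply/matrixP => i j; rewrite !mxE.
by rewrite d1.
Qed.

Lemma laplacian_absmx_split :
  D *m laplacian Bc *m D = laplacian (absmx Bc) /\
  D *m laplacian Bd *m D = laplacian (absmx Bd).
Proof.
have [d [d1 -> dB]] := balancingP B0 balancing_xget.
have [dc dd] := sign_consistent_conj hsign d1 dB.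
by split; exact: laplacian_conj.
Qed.

(* Each conjugated Laplacian annihilates the all-ones vector, hence factors
   through the disagreement [E D x]. *)
Lemma balanced_factor :
  D *m laplacian Bc = D *m laplacian Bc *m D *m Fmx R n *m (Emx R n *m D) /\
  D *m laplacian Bd = D *m laplacian Bd *m D *m Fmx R n *m (Emx R n *m D).
Proof.
have [Dc Dd] := laplacian_absmx_split.
have fac (M : 'M[R]_n) : D *m M *m D *m ones = 0 ->
    D *m M = D *m M *m D *m Fmx R n *m (Emx R n *m D).
  move=> M1; rewrite mulmxA -[_ *m Fmx R n *m Emx R n]mulmxA mulmx_Fmx_Emx//.
  by rewrite -[RHS]mulmxA signature_involutive mulmx1.
by split; apply: fac; rewrite ?Dc ?Dd laplacian_absmx1.
Qed.

Lemma reducedD (M1 M2 : 'M[R]_n) :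
  reduced D (M1 + M2) = reduced D M1 + reduced D M2.
Proof. by rewrite /reduced mulmxDr !mulmxDl. Qed.

Lemma reducedZ a (M : 'M[R]_n) : reduced D (a *: M) = a *: reduced D M.
Proof. by rewrite /reduced -scalemxAr -!scalemxAl. Qed.

(** By [balanced_factor], E D x and E D y satisfy a closed coupled system driven by the reduced
    Laplacians. *)
Lemma disagreement_stable x y : is_solution Bc Bd k x y ->
  0 < k /\ Emx R n *m D *m x t @[t --> +oo] --> (0 : 'cV[R]_n.-1).
Proof.
move=> sol; have solD := is_solution_derive sol.
have m_gt0 : (0 < n.-1)%N by rewrite -ltnS prednK.
have [G [pG]] := reduced_laplacian_stable hn B0 hconn nu_gt0 nuL nu1.
rewrite -balancing_xget.2 laplacianD//.
rewrite (_ : Emx R n *m _ *m Fmx R n =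
             reduced D (laplacian Bc) + reduced D (laplacian Bd)); last first.
  by rewrite -reducedD /reduced !mulmxA.
move=> pQ; have [pH lyap] := lyapunov_solutionP m_gt0 pG pQ.
have hk' : lambda_max (lyapunov_solution
      (reduced D (laplacian Bc) + reduced D (laplacian Bd))) *
    lambda_max ((reduced D (laplacian Bc) + delta *: reduced D (laplacian Bd)) *m
      (reduced D (laplacian Bc) + delta *: reduced D (laplacian Bd))^T)
    / (2 * (delta - 1)) < k.
  by move: hk; rewrite /mu_index bB -reducedZ -!reducedD.
split; first exact: (gain_gt0 m_gt0 pH hdelta hk').
have [facc facd] := balanced_factor.
have [] := coupled_stable m_gt0 pH lyap hdelta hk'
  (x := fun t => Emx R n *m D *m x t) (y := fun t => Emx R n *m D *m y t) => //.
- move=> t /solD[xd _].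
  apply: (is_derive_eq (is_derive_mulmx (Emx R n *m D) xd)).
  rewrite mulmxDr mulmxN; congr (- _ + _).
  by rewrite [LHS]mulmxA -(mulmxA (Emx R n) D (laplacian Bc)) facc /reduced !mulmxA.
- move=> t /solD[_ yd].
  apply: (is_derive_eq (is_derive_mulmx (Emx R n *m D) yd)).
  rewrite mulmxBr mulmxN -!scalemxAr; congr (- (_ *: _) - _).
  by rewrite [LHS]mulmxA -(mulmxA (Emx R n) D (laplacian Bd)) facd /reduced !mulmxA.
Qed.

(** Each coordinate r of D y solves r' = -k g - k r, and the forcing g tends to 0 because D L_d x
    depends only on the disagreement. *)
Lemma balanced_control_vanishes x y : is_solution Bc Bd k x y ->
  y t @[t --> +oo] --> (0 : 'cV[R]_n).
Proof.
move=> sol; have solD := is_solution_derive sol.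
have [k0 ED0] := disagreement_stable sol.
have [_ facd] := balanced_factor.
suff Dy0 : D *m y t @[t --> +oo] --> (0 : 'cV[R]_n).
  rewrite (_ : y = fun t => D *m (D *m y t)); last first.
    by apply/funext => t; rewrite mulmxA signature_involutive mul1mx.
  by rewrite -[X in _ --> X](mulmx0 _ D); exact: cvg_mulmx.
apply: cvg_mxP => i; rewrite mxE.
pose g (t : R) : R := (D *m laplacian Bd *m x t) i 0.
have g0 : g t @[t --> +oo] --> (0 : R).
  rewrite (_ : g = fun t => (D *m laplacian Bd *m D *m Fmx R n *m
      (Emx R n *m D *m x t)) i 0); last first.
    by apply/funext => t; rewrite mulmxA -facd.
  have -> : 0 = (D *m laplacian Bd *m D *m Fmx R n *m (0 : 'cV[R]_n.-1)) i 0.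
    by rewrite mulmx0 mxE.
  exact: cvg_mx_coord (cvg_mulmx ED0).
have g2 : k * (g t * g t) @[t --> +oo] --> (0 : R).
  by have := cvgM (cvg_cst k) (cvgM g0 g0); rewrite !mulr0; apply.
pose r (t : R) : R := (D *m y t) i 0.
have rd (t : R) : 0 < t -> is_derive t 1 r (- (k * g t) - k * r t).
  move=> /solD[_ /(is_derive_mulmx D)/is_derive_mxP/(_ i)] h.
  apply: (is_derive_eq h); rewrite mulmxBr mulmxN -!scalemxAr mulmxA.
  rewrite [LHS]mxE [X in X + _ = _]mxE [X in - X + _ = _]mxE.
  by rewrite [X in _ + X = _]mxE [X in _ - X = _]mxE.
(* The comparison is applied to r^2: by k (r + g)^2 >= 0, its derivative is at most -k r^2 + k
   g^2. *)
apply: (@cvg0_sqr_le _ r (fun t => r t ^+ 2) 1) => [t|]; first by rewrite mul1r.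
apply: (@decay_comparison _ _
  (fun t => 2 * r t * (- (k * g t) - k * r t)) _ k k0) g2 => [t t0|t t0|t].
- have := is_deriveM (rd t t0) (rd t t0); rewrite /GRing.scale /= => h.
  rewrite (_ : (fun t => r t ^+ 2) = r * r); last by apply/funext => s; rewrite expr2.
  by apply: (is_derive_eq h); ring.
- have : 0 <= k * (r t + g t) ^+ 2 by rewrite mulr_ge0 ?sqr_ge0// ltW.
  lra.
- exact: sqr_ge0.
Qed.

Lemma balanced_limit x y : is_solution Bc Bd k x y ->
  x t @[t --> +oo] -->
    (nu^T *m D *m (x 0 + k^-1 *: y 0)) 0 0 *: (D *m ones).
Proof.
move=> sol; have solD := is_solution_derive sol.
have [k0 ED0] := disagreement_stable sol.
have y0 := balanced_control_vanishes sol.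
pose w (t : R) := x t + k^-1 *: y t.
pose f (t : R) : R := (nu^T *m D *m w t) 0 0.
have fd (t : R) : 0 < t -> is_derive t 1 f 0.
  move=> /solD[xd yd].
  have wd : is_derive t 1 w (- (laplacian B *m x t)).
    have ykd := is_derive_mulmx (k^-1)%:M yd.
    have : is_derive t 1 w (- (laplacian Bc *m x t) + y t
       + (k^-1)%:M *m (- (k *: (laplacian Bd *m x t)) - k *: y t)).
      rewrite (_ : w = x + (fun s => (k^-1)%:M *m y s)); last first.
        by apply/funext => s; rewrite /w -mul_scalar_mx.
      exact: is_deriveD.
    move=> /is_derive_eq; apply.
    rewrite mul_scalar_mx scalerBr scalerN !scalerA mulVf ?gt_eqF// !scale1r.
    by rewrite laplacianD// mulmxDl opprD addrACA subrr addr0.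
  have /is_derive_mxP/(_ 0) h := is_derive_mulmx (nu^T *m D) wd.
  apply: (is_derive_eq h).
  (* Since D D = 1, nu^T D L_B = nu^T (D L_B D) D = nu^T L_|B| D = 0. *)
  rewrite mulmxN mulmxA -(mulmxA nu^T) -[D *m laplacian B]mulmx1.
  rewrite -signature_involutive (mulmxA _ D) balancing_xget.2 !mulmxA nuL.
  by rewrite !mul0mx oppr0 mxE.
have f0 : f t @[t --> +oo] --> f 0.
  apply: constant_of_derive0 fd _.
  have [xi yi] := is_solution_init sol.
  apply: cvg_mx_coord; apply: cvg_mulmx; apply: cvgD => //.
  exact: cvgZ (cvg_cst _) yi.
pose g (t : R) : R := f t - k^-1 * (nu^T *m D *m y t) 0 0.
have gE t : g t = (nu^T *m (D *m x t)) 0 0.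
  rewrite /g /f /w mulmxDr -scalemxAr mulmxA.
  by rewrite [X in X - _ = _]mxE [X in _ + X - _ = _]mxE addrK.
have g0 : g t @[t --> +oo] --> f 0.
  rewrite -[X in _ --> X]subr0; apply: cvgB => //.
  rewrite -(mulr0 k^-1); apply: cvgM; first exact: cvg_cst.
  have := cvg_mx_coord (i := 0) (cvg_mulmx (A := nu^T *m D) y0).
  by rewrite mulmx0 mxE; apply.
pose P : 'M[R]_n := 1%:M - ones *m nu^T.
have P1 : P *m ones = 0 by rewrite mulmxBl mul1mx -mulmxA nu1 mulmx1 subrr.
(* D x splits into its nu-weighted mean times [ones] and P D x; the latter is a function of the
   disagreement because P annihilates [ones]. *)
have xE t : x t = g t *: (D *m ones)
                  + D *m P *m Fmx R n *m (Emx R n *m D *m x t).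
  rewrite -[D *m P *m Fmx R n]mulmxA [RHS](_ : _ =
    g t *: (D *m ones) + D *m (P *m (Fmx R n *m Emx R n)) *m (D *m x t)); last first.
    by rewrite !mulmxA.
  rewrite mulmx_Fmx_Emx// -mulmxA mulmxBl mul1mx mulmxBr (mulmxA D D).
  rewrite signature_involutive mul1mx -(mulmxA ones) [nu^T *m _]mx11_scalar -gE.
  by rewrite mul_mx_scalar -scalemxAr addrC subrK.
have xF : x = fun t => g t *: (D *m ones)
                  + D *m P *m Fmx R n *m (Emx R n *m D *m x t) by exact/funext.
have c1 : g t *: (D *m ones) @[t --> +oo] --> f 0 *: (D *m ones).
  by apply: cvgZ g0 _; exact: cvg_cst.
have c2 : D *m P *m Fmx R n *m (Emx R n *m D *m x t) @[t --> +oo] -->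
    (0 : 'cV[R]_n).
  by rewrite -(mulmx0 _ (D *m P *m Fmx R n)); exact: cvg_mulmx.
by have := cvgD c1 c2; rewrite addr0 [in X in _ -> X --> _]xF; apply.
Qed.

End Main.

Theorem theorem1 (R : realType) (n : nat) (hn : (2 <= n)%N)
    (Bc Bd : 'M[R]_n)
    (hBc : adjacency_matrix Bc) (hBd : adjacency_matrix Bd)
    (hsign : sign_consistent Bc Bd)
    (delta : R) (hdelta : 1 < delta)
    (k : R) (hk : mu_index Bc Bd delta < k)
    (hconn : strongly_connected (Bc + Bd)) :
  let B := Bc + Bd in
  [/\ polarization Bc Bd k <-> structurally_balanced B,
      structurally_balanced B ->
        exists D : 'M[R]_n, exists nu : 'cV[R]_n,
          [/\ signature_matrix D,
              D *m laplacian B *m D = laplacian (absmx B),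
              nu^T *m (D *m laplacian B *m D) = 0,
              nu^T *m (const_mx 1 : 'cV[R]_n) = 1%:M &
              forall x y : R -> 'cV[R]_n, is_solution Bc Bd k x y ->
                x t @[t --> +oo] -->
                  (nu^T *m D *m (x 0 + k^-1 *: y 0)) 0 0
                    *: (D *m (const_mx 1 : 'cV[R]_n)) /\
                y t @[t --> +oo] --> (0 : 'cV[R]_n)] &
      neutralization Bc Bd k <-> ~~ structurally_balanced B].
Proof.
move=> B; have n_gt0 : (0 < n)%N := ltnW hn.
have B0 : adjacency_matrix B := adjacency_matrixD hBc hBd.
have [nu [nu_gt0 nuL nu1]] := laplacian_left_null n_gt0 B0 hconn.
set ones := const_mx 1 : 'cV[R]_n in nu1 *.
pose D : 'M[R]_n := xget 0 [set D | balancing_matrix B D].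
have lim bB x y (sol : is_solution Bc Bd k x y) :=
  conj (balanced_limit hn hBc hBd hsign hdelta hk hconn bB nu_gt0 nuL nu1 sol)
    (balanced_control_vanishes hn hBc hBd hsign hdelta hk hconn bB nu_gt0 nuL nu1 sol).
have stable := unbalanced_stable hn hBc hBd hsign hdelta hk hconn.
have D1 i : structurally_balanced B -> `|(D *m ones) i 0| = 1.
  move=> bB; have [[d d1 DE] _] := balancing_xget bB.
  rewrite /D DE mul_diag_mx !mxE mulr1.
  by case: (d1 i) => ->; rewrite ?normrN normr1.
split.
- split=> [[theta [_ [x0 [y0 [x1 [y1 th]]]] thlim]]|bB].
    apply: contra_notT th => uB.
    (* Some solution starts at (a, b) and tends to 0, so [theta] would be identically 0. *)
    have th0 a b : theta a b = 0.
      have [x [y [sol xa yb]]] := is_solution_exists Bc Bd k a b.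
      have [xth _] := thlim x y sol (Ordinal n_gt0).
      have [x0' _] := stable x y uB sol.
      have x0'' := cvg_mx_coord_norm (i := Ordinal n_gt0) x0'.
      by rewrite -xa -yb (cvg_unique _ xth x0'') ?mxE ?normr0.
    by rewrite !th0.
  exists (fun a b => `|(nu^T *m D *m (a + k^-1 *: b)) 0 0|); split => [//||x y sol i].
    (* At (D 1, 0) the value is nu^T D D 1 = 1, and at (0, 0) it is 0. *)
    exists (D *m ones), 0, 0, 0; rewrite !scaler0 !addr0 mulmx0.
    rewrite mulmxA -(mulmxA nu^T) (signature_involutive hBc hBd bB) mulmx1 nu1.
    by rewrite !mxE normr0 normr1 => /eqP; rewrite oner_eq0.
  have [xl yl] := lim bB x y sol; split.
    have := cvg_mx_coord_norm (i := i) xl.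
    by rewrite mxE normrM D1// mulr1.
  exact: cvg_mx_coord0.
- move=> bB; exists D, nu; have [sD DB] := balancing_xget bB.
  split => //; first by rewrite DB.
  by move=> x y; exact: lim.
- split=> [neu|uB x y sol i]; last first.
    have [xl yl] := stable x y uB sol.
    by split; exact: cvg_mx_coord0.
  apply/negP => bB.
  have [Lc Ld] := laplacian_absmx_split hBc hBd hsign bB.
  have ann (M : 'M[R]_n) : D *m M *m D *m ones = 0 -> M *m (D *m ones) = 0.
    move=> M1; rewrite -[LHS]mul1mx -(signature_involutive hBc hBd bB) -/D.
    have -> : D *m D *m (M *m (D *m ones)) = D *m (D *m M *m D *m ones).
      by rewrite !mulmxA.
    by rewrite M1 mulmx0.
  (* Both Laplacians annihilate D 1, which is therefore an equilibrium with entries of modulus 1. *)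
  have sol : is_solution Bc Bd k (cst (D *m ones)) (cst 0).
    rewrite /is_solution /=; split => [t _|]; last exact: cvg_cst.
    rewrite system_matrix_mulmx ann ?Lc ?laplacian_absmx1//.
    rewrite ann ?Ld ?laplacian_absmx1//.
    rewrite !scaler0 oppr0 !addr0 col_mx0.
    exact: is_derive_cst.
  have [x0 _] := neu _ _ sol (Ordinal n_gt0).
  have c1 : (0 : R) = (D *m ones) (Ordinal n_gt0) 0.
    exact: (cvg_unique _ x0 (cvg_cst _)).
  have := D1 (Ordinal n_gt0) bB; rewrite -c1 normr0 => /eqP.
  by rewrite eq_sym oner_eq0.
Qed.
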